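(* Let $M$ be a $d$-dimensional manifold and let $f_\lambda:M\to M$ be a family of homeomorphisms continuously depending on $\lambda\in[0,1]$. Let $N\subset M$ be an $n$-dimensional submanifold which is invariant under $f_\lambda$ for all $\lambda$. Suppose that the point $p\in N$ is an attractor for $f_0$ and a repeller for the restriction $f_\lambda|_N$ for every $\lambda>0$. Suppose, additionally, that there exists a neighborhood $V$ of $p$ in $M$ (the same for all $\lambda$) such that the maximal invariant set of $f_\lambda$ inside $V$ is contained in $N$. Then there exists $\lambda_0>0$ such that for every $\lambda$ with $0<\lambda<\lambda_0$ there exists an attractor $K_\lambda$ of $f_\lambda$ (on $M$) which has the Borsuk homotopy type (shape) of $S^{n-1}$. Moreover, the family $\{K_\lambda\}$ converges to $\{p\}$ upper semicontinuously as $\lambda$ tends to $0$.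
   Context: Manifolds are topological manifolds (metrizable, without boundary). Continuous dependence on $\lambda$ means that $(x,\lambda)\mapsto f_\lambda(x)$ is continuous on $M\times[0,1]$. A set $A$ is invariant for a homeomorphism $f$ if $f(A)=A$; the maximal invariant set of $f$ inside $V$ is the largest invariant subset of $V$. Attractors and repellers. For a homeomorphism $f:X\to X$ of a locally compact metric space and $Y\subset X$, let $\omega(Y)=\bigcap_{n>0}\overline{\bigcup_{k\ge n}f^k(Y)}$. A compactum $K\subset X$ is an attractor of $f$ if it has a neighborhood $U$ with $K=\omega(U)$. A compactum is a repeller of $f$ if it is an attractor of $f^{-1}$. A point $p$ is called an attractor (repeller) if $\{p\}$ is one. Shape (Borsuk homotopy type) is in the sense of Borsuk's shape theory for compact metric spaces: two compacta have the same shape if they are isomorphic in the shape category; equivalently, writing each as an inverse limit of a sequence of compact polyhedra, the two inverse sequences are isomorphic in the pro-category of the homotopy category of polyhedra. Upper semicontinuous convergence of $K_\lambda$ to $K$ as $\lambda\to0$: for every neighborhood $U$ of $K$ in $M$ there is $\lambda_U>0$ such that $K_\lambda\subset U$ for all $0<\lambda<\lambda_U$. *)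

(* Defs.v *)
From HB Require Import structures.
From mathcomp Require Import all_boot all_order all_algebra.
From mathcomp Require Import all_classical all_reals all_analysis.
Export numFieldNormedType.Exports.

Set Implicit Arguments.
Unset Strict Implicit.
Unset Printing Implicit Defensive.

Import Order.TTheory GRing.Theory Num.Theory.
Local Open Scope classical_set_scope.
Local Open Scope ring_scope.

(* Throughout, a topological space is a set [X : set T] in an ambient space [T],
   carrying the subspace topology; a map X -> Y is a total function between the
   ambient types of which only the values on X matter (this is harmless as long
   as the ambient types are inhabited). *)

Definition is_map (S T : topologicalType) (X : set S) (Y : set T)
    (f : S -> T) : Prop :=
  {within X, continuous f} /\ set_fun X Y f.

Definition inverse_homeos (S T : topologicalType) (X : set S) (Y : set T)
    (f : S -> T) (g : T -> S) : Prop :=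
  [/\ is_map X Y f, is_map Y X g,
      (forall x, X x -> g (f x) = x) & (forall y, Y y -> f (g y) = y)].

Definition is_homeo (S T : topologicalType) (X : set S) (Y : set T)
    (f : S -> T) : Prop :=
  exists g, inverse_homeos X Y f g.

Definition homeomorphic (S T : topologicalType) (X : set S) (Y : set T) : Prop :=
  exists f, is_homeo X Y f.

(* Metrizability is inherited from the ambient metric space.  No local flatness
   or closedness is imposed on X as a subset of T. *)
Definition manifold (R : realType) (n : nat) (T : metricType R) (X : set T) : Prop :=
  forall x, X x ->
    exists O, [/\ open O, O x & homeomorphic (X `&` O) [set: 'rV[R]_n]].

(* For n = 0 this is the empty set. *)
Definition sphere (R : realType) (n : nat) : set 'rV[R]_n :=
  [set x | \sum_(i < n) x ord0 i ^+ 2 = 1].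

Section Dynamics.
Context {T : topologicalType}.
Implicit Types (X Y K : set T) (f : T -> T).

(* The closure of Z in the subspace X is [X `&` closure Z]. *)
Definition omega_limit X f Y : set T :=
  \bigcap_(n in [set n | (0 < n)%N])
    (X `&` closure (\bigcup_(k in [set k | (n <= k)%N]) (iter k f @` Y))).

(* [W `&` X], with W a neighborhood of K in T, is the general form of a
   neighborhood of K in X. *)
Definition attractor X f K : Prop :=
  [/\ compact K, K `<=` X &
      exists2 W, set_nbhs K W & K = omega_limit X f (W `&` X)].

Definition repeller X f K : Prop :=
  exists2 g, inverse_homeos X X f g & attractor X g K.

Definition maximal_invariant f (V : set T) : set T :=
  \bigcup_(A in [set A | A `<=` V /\ f @` A = A]) A.

End Dynamics.

Definition homotopic (R : realType) (S T : topologicalType)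
    (X : set S) (Y : set T) (f g : S -> T) : Prop :=
  exists H : S * R -> T,
    [/\ @is_map (S * R)%type T (X `*` `[0, 1]) Y H,
        (forall x, X x -> H (x, 0) = f x) & (forall x, X x -> H (x, 1) = g x)].

Definition convex_hull (R : realType) (m : nat) (s : seq 'rV[R]_m) : set 'rV[R]_m :=
  [set x | exists w : 'I_(size s) -> R,
     [/\ forall i, 0 <= w i, \sum_i w i = 1 & x = \sum_i w i *: s`_i]].

(* A finite union of convex polytopes in a Euclidean space. *)
Definition compact_polyhedron (R : realType) (m : nat) (P : set 'rV[R]_m) : Prop :=
  exists ss : seq (seq 'rV[R]_m), P = \bigcup_(s in [set` ss]) convex_hull s.

Unset Implicit Arguments.

(* [bond i j] is the bonding map space j -> space i; it is meaningful only for
   i <= j. *)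
Record inverse_sequence (R : realType) := InverseSequence {
  space_dim : nat -> nat ;
  space : forall i, set 'rV[R]_(space_dim i) ;
  bond : forall i j, 'rV[R]_(space_dim j) -> 'rV[R]_(space_dim i) ;
  space_polyhedron : forall i, compact_polyhedron (space i) ;
  bond_map : forall i j, (i <= j)%N -> is_map (space j) (space i) (bond i j) ;
  bond_id : forall i x, space i x -> bond i i x = x ;
  bond_comp : forall i j k, (i <= j)%N -> (j <= k)%N ->
    forall x, space k x -> bond i j (bond j k x) = bond i k x }.

Set Implicit Arguments.

Arguments space_dim {R} X i : rename.
Arguments space {R} X i : rename.
Arguments bond {R} X i j : rename.

Section Shape.
Context {R : realType}.
Implicit Types X Y Z : inverse_sequence R.

Definition inverse_limit X : set (prod_topology (fun i => 'rV[R]_(space_dim X i))) :=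
  [set x | (forall i, space X i (x i)) /\
           (forall i j, (i <= j)%N -> bond X i j (x j) = x i)].

(* Representatives of morphisms in the pro-category of the homotopy category;
   the conditions on the components are stated in [is_pro_map]. *)
Record pro_map X Y := ProMap {
  pro_index : nat -> nat ;
  pro_component : forall j,
    'rV[R]_(space_dim X (pro_index j)) -> 'rV[R]_(space_dim Y j) }.

Arguments pro_index {X Y} h j : rename.
Arguments pro_component {X Y} h j x : rename.

Definition is_pro_map X Y (h : pro_map X Y) : Prop :=
  (forall j, is_map (space X (pro_index h j)) (space Y j) (pro_component h j)) /\
  (forall j j', (j <= j')%N ->
     exists i, [/\ (pro_index h j <= i)%N, (pro_index h j' <= i)%N &
       homotopic R (space X i) (space Y j)
         (pro_component h j \o bond X (pro_index h j) i)
         (bond Y j j' \o pro_component h j' \o bond X (pro_index h j') i)]).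

Definition pro_id X : pro_map X X :=
  @ProMap X X id (fun j => id).

Definition pro_comp X Y Z (h : pro_map Y Z) (g : pro_map X Y) : pro_map X Z :=
  @ProMap X Z (fun k => pro_index g (pro_index h k))
    (fun k => pro_component h k \o pro_component g (pro_index h k)).

Definition pro_equiv X Y (h h' : pro_map X Y) : Prop :=
  forall j, exists i, [/\ (pro_index h j <= i)%N, (pro_index h' j <= i)%N &
    homotopic R (space X i) (space Y j)
      (pro_component h j \o bond X (pro_index h j) i)
      (pro_component h' j \o bond X (pro_index h' j) i)].

Definition pro_isomorphic X Y : Prop :=
  exists (h : pro_map X Y) (g : pro_map Y X),
    [/\ is_pro_map h, is_pro_map g,
        pro_equiv (pro_comp g h) (pro_id X) &
        pro_equiv (pro_comp h g) (pro_id Y)].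

End Shape.

Arguments inverse_limit {R} X x : rename.

(* Any two polyhedral inverse sequences with homeomorphic limits are
   pro-isomorphic, so the choice of X and Y is immaterial. *)
Definition same_shape (R : realType) (S T : topologicalType)
    (A : set S) (B : set T) : Prop :=
  exists X Y : inverse_sequence R,
    [/\ homeomorphic A (inverse_limit X), homeomorphic B (inverse_limit Y) &
        pro_isomorphic X Y].

(* The bound lU <= l0 keeps l within the range ]0, l0[ on which the family K is
   considered. *)
Definition upper_semicontinuous_to (R : realType) (T : topologicalType)
    (l0 : R) (K : R -> set T) (K0 : set T) : Prop :=
  forall U, set_nbhs K0 U ->
    exists2 lU, 0 < lU <= l0 & forall l, 0 < l < lU -> K l `<=` U.

(* Main.v *)
Require Import Defs.
From mathcomp Require Import all_boot all_order all_algebra.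
From mathcomp Require Import all_classical all_reals all_analysis.
Import Order.TTheory GRing.Theory Num.Theory.
Local Open Scope classical_set_scope.
Local Open Scope ring_scope.
Set Implicit Arguments.
Unset Strict Implicit.
Unset Printing Implicit Defensive.

(** Since [p] attracts for [f 0], some compact neighborhood [B] of [p] has all
    its late images under [f 0] in a prescribed small neighborhood [G] of [p];
    by compactness of [B] the same holds for [f l] with [l] small
    ([iterate_persistence]).  The set [A] of points whose whole backward orbit
    lies in [B] ([trapped_core]) is then an attractor of [f l], and, being
    invariant and contained in [V], it lies in [N].  On [N] the point [p]
    repels, so a small disc about [p] in [N], the trace on [N] of an open set [W],
    is pulled into itself by high iterates of the inverse of [f l].  Removing
    from [A] the points whose backward orbit enters [W] leaves a compact invariant set [K] ([dual_attractor]): the attractor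
    dual to the repeller [p] in [A].  An attractor of an attractor is an
    attractor, so [K] is one on the whole of [M] ([dual_is_attractor]).

    For the shape, read everything in a chart of [N] centered at [p].  The
    images, under high iterates of [f l], of a round annulus about [p] are
    neighborhoods of [K] in [N] that shrink to [K].  Each of them is an annulus
    [Q] embedded around the origin, not necessarily in a standard way, but the
    radial projection from [Q] to the unit sphere is always a homotopy
    equivalence ([embedded_annulus_equivalence]).  The reason is that
    round and embedded discs about the origin are nested in one another, and
    each deforms radially into arbitrarily small ones.  Interleaving the sets
    [Q] with polyhedral neighborhoods of [K] makes the latter an inverse
    sequence pro-isomorphic, through radial projections, to the constant
    sequence at the sphere ([nested_annuli_shape]).

    Distances in Euclidean space are taken in the sup norm, which makes discs
    and spheres polyhedra. *)

(** * Maps and homotopies between subsets *)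

(** Continuity on [X] unfolded to ambient neighborhoods, the form used
    throughout to compose maps between subsets. *)
Lemma within_continuousE (S T : topologicalType) (X : set S) (f : S -> T) :
  {within X, continuous f} <->
  forall x, X x -> forall W, nbhs (f x) W -> \forall y \near x, X y -> W (f y).
Proof. by rewrite subspace_continuousP; split => fc x /fc. Qed.

Section Maps.
Context {S T U : topologicalType}.

Lemma is_map_comp (X : set S) (Y : set T) (Z : set U) (f : S -> T) (g : T -> U) :
  is_map X Y f -> is_map Y Z g -> is_map X Z (g \o f).
Proof.
move=> [/within_continuousE fc fXY] [/within_continuousE gc gYZ]; split.
  apply/within_continuousE => x Xx W Wgfx.
  have := fc x Xx _ (gc _ (fXY _ Xx) _ Wgfx); apply: filterS => y + Xy.
  by move=> /(_ Xy); apply; apply: fXY.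
by move=> x Xx; apply: gYZ; apply: fXY.
Qed.

Lemma is_map_sub (X X' : set S) (Y Y' : set T) (f : S -> T) :
  X' `<=` X -> Y `<=` Y' -> is_map X Y f -> is_map X' Y' f.
Proof.
move=> XX YY [fc fXY]; split; first exact: continuous_subspaceW fc.
by move=> x /XX /fXY /YY.
Qed.

Lemma eq_is_map (X : set S) (Y : set T) (f g : S -> T) :
  (forall x, X x -> f x = g x) -> is_map X Y f -> is_map X Y g.
Proof.
move=> fg [fc fXY]; split; last by move=> x Xx; rewrite -fg//; exact: fXY.
by apply: subspace_eq_continuous fc => x /set_mem; exact: fg.
Qed.

Lemma is_map_pair (X : set S) (Y : set T) (Z : set U) (f : S -> T) (g : S -> U) :
  is_map X Y f -> is_map X Z g -> is_map X (Y `*` Z) (fun x => (f x, g x)).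
Proof.
move=> [/within_continuousE fc fXY] [/within_continuousE gc gYZ]; split.
  apply/within_continuousE => x Xx W [[A B] /= [Afx Bgx] ABW].
  apply: filterS2 (fc x Xx _ Afx) (gc x Xx _ Bgx) => y Ay By Xy.
  by apply: ABW; split; [exact: Ay|exact: By].
by move=> x Xx; split; [exact: fXY|exact: gYZ].
Qed.

Lemma continuous_is_map (X : set S) (Y : set T) (f : S -> T) :
  (forall x, X x -> {for x, continuous f}) -> (forall x, X x -> Y (f x)) ->
  is_map X Y f.
Proof.
move=> fc fXY; split; last exact: fXY.
apply/within_continuousE => x Xx W Wfx.
have fW : nbhs x (f @^-1` W) := fc x Xx W Wfx.
by apply: filterS fW.
Qed.

End Maps.

Lemma is_map_id (S : topologicalType) (X Y : set S) : X `<=` Y -> is_map X Y id.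
Proof. by move=> XY; apply: continuous_is_map => // x _; exact: cvg_id. Qed.

Lemma is_map_iter (S : topologicalType) (X : set S) (f : S -> S) k :
  is_map X X f -> is_map X X (iter k f).
Proof.
by move=> fX; elim: k => [|k ih]; [exact: is_map_id|exact: is_map_comp ih fX].
Qed.

Lemma is_map_fst (S T : topologicalType) (X : set S) (Y : set T) :
  is_map (X `*` Y) X fst.
Proof. by apply: continuous_is_map => [x _|x []//]; exact: cvg_fst. Qed.

Lemma is_map_snd (S T : topologicalType) (X : set S) (Y : set T) :
  is_map (X `*` Y) Y snd.
Proof. by apply: continuous_is_map => [x _|x []//]; exact: cvg_snd. Qed.

Section Homeos.
Context {S T U : topologicalType}.

Lemma homeomorphic_trans (X : set S) (Y : set T) (Z : set U) :
  homeomorphic X Y -> homeomorphic Y Z -> homeomorphic X Z.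
Proof.
move=> [f [f' [fm f'm fK f'K]]] [g [g' [gm g'm gK g'K]]].
exists (g \o f), (f' \o g'); split.
- exact: is_map_comp fm gm.
- exact: is_map_comp g'm f'm.
- by move=> x Xx /=; rewrite gK ?fK//; exact: fm.2.
- by move=> x Xx /=; rewrite f'K ?g'K//; exact: g'm.2.
Qed.

Lemma inverse_homeos_sub (X X' : set S) (Y Y' : set T) f g :
  X' `<=` X -> Y' `<=` Y -> set_fun X' Y' f -> set_fun Y' X' g ->
  inverse_homeos X Y f g -> inverse_homeos X' Y' f g.
Proof.
move=> XX YY fXY gYX [[fc _] [gc _] gf fg]; split.
- by split=> //; exact: continuous_subspaceW fc.
- by split=> //; exact: continuous_subspaceW gc.
- by move=> x /XX; exact: gf.
- by move=> x /YY; exact: fg.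
Qed.

End Homeos.

Section Homotopies.
Context {R : realType}.

Lemma homotopic_refl (S T : topologicalType) (X : set S) (Y : set T) f g :
  is_map X Y f -> (forall x, X x -> f x = g x) -> homotopic R X Y f g.
Proof.
move=> fm fg; exists (f \o fst); split => //.
exact: is_map_comp (is_map_fst _ _) fm.
Qed.

Lemma homotopic_sym (S T : topologicalType) (X : set S) (Y : set T) f g :
  homotopic R X Y f g -> homotopic R X Y g f.
Proof.
move=> [H [Hm H0 H1]]; exists (H \o (fun z => (z.1, 1 - z.2))); split.
- apply: is_map_comp _ Hm; apply: is_map_pair; first exact: is_map_fst.
  apply: continuous_is_map => [[x t] _|[x t] [_]]/=.
    by apply: cvgB; [exact: cvg_cst|exact: cvg_snd].
  by rewrite !in_itv/= => /andP[t0 t1]; rewrite subr_ge0 t1 gerBl.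
- by move=> x Xx /=; rewrite subr0 H1.
- by move=> x Xx /=; rewrite subrr H0.
Qed.

(** Two homotopies are pasted along the slice at time 1/2; closedness of [X]
    makes both halves of the cylinder closed, so that the pasting lemma
    applies. *)
Lemma homotopic_trans (S T : topologicalType) (X : set S) (Y : set T) f g h :
  closed X -> homotopic R X Y f g -> homotopic R X Y g h -> homotopic R X Y f h.
Proof.
move=> Xcl [H [Hm H0 H1]] [G [Gm G0 G1]].
pose a (z : S * R) := (z.1, 2 * z.2); pose b (z : S * R) := (z.1, 2 * z.2 - 1).
pose c := 2^-1 : R.
pose A : set (S * R) := X `*` `[0, c]; pose B : set (S * R) := X `*` `[c, 1].
have c0 : 0 < c by rewrite invr_gt0.
have c1 : c <= 1 by rewrite invf_le1// ler1n.
have am : @is_map _ (S * R)%type A (X `*` `[0, 1]) a.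
  apply: is_map_pair; first exact: is_map_fst.
  apply: continuous_is_map => [[x t] _|[x t] [_]]/=.
    by apply: cvgM; [exact: cvg_cst|exact: cvg_snd].
  rewrite !in_itv/= => /andP[t0 t1]; rewrite mulr_ge0//=.
  by rewrite -ler_pdivlMl// mulr1.
have bm : @is_map _ (S * R)%type B (X `*` `[0, 1]) b.
  apply: is_map_pair; first exact: is_map_fst.
  apply: continuous_is_map => [[x t] _|[x t] [_]]/=.
    apply: cvgB; last exact: cvg_cst.
    by apply: cvgM; [exact: cvg_cst|exact: cvg_snd].
  rewrite !in_itv/= => /andP[t0 t1]; rewrite subr_ge0 lerBlDl.
  by rewrite -ler_pdivrMl// mulr1 t0/= -[leRHS](mulr1 2) ler_pM2l.
pose K (z : S * R) := if z.2 <= c then H (a z) else G (b z).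
have KA : is_map A Y K.
  by apply: eq_is_map (is_map_comp am Hm) => -[x t] [_]/=;
    rewrite in_itv/= /K/= => /andP[_ ->].
have KB : is_map B Y K.
  apply: eq_is_map (is_map_comp bm Gm) => -[x t] [/= Xx].
  rewrite in_itv/= /K/= /a /b/= => /andP[ct _]; case: ifPn => // tc.
  have -> : t = c by apply/eqP; rewrite eq_le tc ct.
  by rewrite mulfV// subrr H1// G0.
have AB : X `*` `[0, 1] = A `|` B.
  apply/seteqP; split=> -[x t] /=.
    move=> [Xx]; rewrite in_itv/= => /andP[t0 t1].
    have [tc|/ltW tc] := leP t c; [left|right]; split => //=;
    by rewrite in_itv/= ?t0 ?t1 tc.
  case=> -[/= Xx]; rewrite in_itv/= => /andP[t0 t1]; split => //=; rewrite in_itv/=.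
    by rewrite t0 (le_trans t1).
  by rewrite t1 (le_trans _ t0)// ltW.
have cA (u v : R) : closed (X `*` `[u, v]).
  have -> : X `*` `[u, v] = fst @^-1` X `&` snd @^-1` `[u, v] by [].
  apply: closedI; apply: preimage_closed => //; try exact: itv_closed.
  - by move=> ? _; exact: cvg_fst.
  - by move=> ? _; exact: cvg_snd.
exists K; split.
- rewrite AB; split; first exact: withinU_continuous (cA _ _) (cA _ _) KA.1 KB.1.
  by move=> z [/KA.2|/KB.2].
- by move=> x Xx; rewrite /K/= ltW// /a/= mulr0 H0.
- move=> x Xx; rewrite /K/= leNgt invf_lt1// ltr1n/= /b/= mulr1.
  by rewrite -[2]/(1 + 1) addrK G1.
Qed.

Lemma homotopic_post (S T U : topologicalType) (X : set S) (Y : set T) (Z : set U)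
    f g h : homotopic R X Y f g -> is_map Y Z h ->
  homotopic R X Z (h \o f) (h \o g).
Proof.
move=> [H [Hm H0 H1]] hm; exists (h \o H); split.
- exact: is_map_comp Hm hm.
- by move=> x Xx /=; rewrite H0.
- by move=> x Xx /=; rewrite H1.
Qed.

Lemma homotopic_pre (S T U : topologicalType) (X : set S) (Y : set T) (Z : set U)
    f g h : is_map X Y h -> homotopic R Y Z f g ->
  homotopic R X Z (f \o h) (g \o h).
Proof.
move=> hm [H [Hm H0 H1]]; exists (H \o (fun z => (h z.1, z.2))); split.
- apply: is_map_comp _ Hm; apply: is_map_pair; last exact: is_map_snd.
  exact: is_map_comp (is_map_fst _ _) hm.
- by move=> x Xx /=; rewrite H0//; exact: hm.2.
- by move=> x Xx /=; rewrite H1//; exact: hm.2.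
Qed.

Lemma homotopic_eq (S T : topologicalType) (X : set S) (Y : set T) f g f' g' :
  (forall x, X x -> f x = f' x) -> (forall x, X x -> g x = g' x) ->
  homotopic R X Y f g -> homotopic R X Y f' g'.
Proof.
move=> ff' gg' [H [Hm H0 H1]]; exists H; split => // x Xx.
- by rewrite H0// ff'.
- by rewrite H1// gg'.
Qed.

Lemma homotopic_sub (S T : topologicalType) (X X' : set S) (Y Y' : set T) f g :
  X' `<=` X -> Y `<=` Y' -> homotopic R X Y f g -> homotopic R X' Y' f g.
Proof.
move=> XX YY [H [Hm H0 H1]]; exists H; split.
- by apply: is_map_sub Hm => // -[x t] [/XX].
- by move=> x /XX /H0.
- by move=> x /XX /H1.
Qed.

Lemma homotopic_is_map (S T : topologicalType) (X : set S) (Y : set T) f g :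
  homotopic R X Y f g -> is_map X Y g.
Proof.
move=> [H [Hm _ H1]].
have im : @is_map S (S * R)%type X (X `*` `[0, 1]) (fun x => (x, 1)).
  apply: is_map_pair; first exact: is_map_id.
  apply: continuous_is_map => [x _|x _ /=]; first exact: cst_continuous.
  by rewrite in_itv/= ler01 lexx.
by apply: eq_is_map (is_map_comp im Hm) => x /H1.
Qed.

End Homotopies.

(** * Compact sets and uniformity *)

(** Each point of [K] has a ball in [U], hence so do all nearby points with half
    the radius; compactness makes one radius work for all. *)
Lemma lebesgue_number (R : realType) (T : pseudoMetricType R) (K U : set T) :
  compact K -> open U -> K `<=` U ->
  exists2 e : R, 0 < e & forall x, K x -> ball x e `<=` U.
Proof.
move=> Kc Uo KU.
have : \forall e \near (0 : R)^'+, K `<=` (fun x => ball x e `<=` U).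
  apply: (compact_near_coveringP K).1 => // x Kx.
  have /nbhs_ballP[r /= r0 rU] := open_nbhs_nbhs (conj Uo (KU _ Kx)).
  near=> y e.
  have xy : ball x (r / 2) y by near: y; apply: nbhsx_ballx; rewrite divr_gt0.
  have er : e <= r / 2 by near: e; apply: nbhs_right_le; rewrite divr_gt0.
  move=> z yz; apply: rU; rewrite (splitr r).
  exact: ball_triangle xy (le_ball er yz).
move=> KF; near (0 : R)^'+ => e; exists e => //.
by near: e.
Unshelve. all: by end_near. Qed.

Lemma compact_closed_separation (R : realType) (T : pseudoMetricType R) (K C : set T) :
  compact K -> closed C -> K `<=` ~` C ->
  exists Z, [/\ open Z, K `<=` Z & closure Z `<=` ~` C].
Proof.
move=> Kc Cc KC; have [e e0 eC] := lebesgue_number Kc (closed_openC Cc) KC.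
have e20 : 0 < e / 2 by rewrite divr_gt0.
exists (\bigcup_(x in K) (ball x (e / 2))°); split.
- by apply: bigcup_open => x _; exact: open_interior.
- by move=> x Kx; exists x => //; exact: nbhsx_ballx.
- move=> y /(_ _ (nbhsx_ballx y _ e20)) [z [[x Kx /nbhs_singleton xz] yz]].
  by apply: (eC x Kx); rewrite (splitr e); exact: ball_triangle xz (ball_sym yz).
Qed.

(** * Annuli for the sup norm *)

Section Annuli.
Context {R : realType} {n : nat}.
Notation V := 'rV[R]_n.
Implicit Types (x y : V) (X : set V) (r s : R).

Definition disc r : set V := [set x | `|x| <= r].
Definition punctured_disc r : set V := [set x | 0 < `|x| <= r].
Definition annulus s r : set V := [set x | s <= `|x| <= r].
(** For the sup norm the unit sphere is the boundary of a cube, hence a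
    polyhedron. *)
Definition cube_sphere : set V := [set x | `|x| = 1].
Definition radial x : V := `|x|^-1 *: x.

Lemma closed_norm (I : set R) : closed I -> closed [set x : V | I `|x|].
Proof.
by move=> Icl; apply: (@preimage_closed V R _ I) => // x _; exact: norm_continuous.
Qed.

Lemma closed_cube_sphere : closed cube_sphere.
Proof. by apply: (@closed_norm [set 1]); exact: closed_eq. Qed.

Lemma compact_disc r : compact (disc r).
Proof.
apply: bounded_closed_compact; last by apply: (@closed_norm [set t | t <= r]);
  exact: closed_le.
exists r; split; first exact: num_real.
by move=> t rt x /= xr; rewrite (le_trans xr)// ltW.
Qed.

Lemma compact_annulus s r : compact (annulus s r).
Proof.
apply: (subclosed_compact _ (@compact_disc r)); last by move=> x /andP[].
by apply: (@closed_norm [set t | s <= t <= r]); rewrite -set_itvcc; exact: itv_closed.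
Qed.

Lemma norm_scale_pos (c : R) x : 0 <= c -> `|c *: x| = c * `|x|.
Proof. by move=> c0; rewrite normrZ ger0_norm. Qed.

Lemma norm_radial x : 0 < `|x| -> `|radial x| = 1.
Proof. by move=> x0; rewrite norm_scale_pos ?invr_ge0// mulVf// gt_eqF. Qed.

Lemma continuous_norm_inv x : 0 < `|x| -> {for x, continuous (fun y => `|y|^-1)}.
Proof.
move=> x0; apply: continuousV; [by rewrite gt_eqF|exact: norm_continuous].
Qed.

Lemma radial_is_map X : (forall x, X x -> 0 < `|x|) -> is_map X cube_sphere radial.
Proof.
move=> X0; apply: continuous_is_map => [x /X0 x0|x /X0]; last exact: norm_radial.
by apply: continuousZ; [exact: continuous_norm_inv|exact: cvg_id].
Qed.

(** A rescaling by positive factors is deformed to the identity through convex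
    combinations of its factor with 1: these remain positive, and a disc is
    convex. *)
Lemma scaling_homotopy X r (c : V -> R) :
  X `<=` punctured_disc r -> (forall x, X x -> {for x, continuous c}) ->
  (forall x, X x -> 0 < c x /\ c x * `|x| <= r) ->
  homotopic R X (punctured_disc r) id (fun x => c x *: x).
Proof.
move=> Xr cc c0.
exists (fun z => ((1 - z.2) + z.2 * c z.1) *: z.1); split.
- apply: continuous_is_map => [[x t] [/= Xx _]|[x t] [/= Xx]].
    apply: cvgZ; last exact: cvg_fst.
    apply: cvgD; first by apply: cvgB; [exact: cvg_cst|exact: cvg_snd].
    apply: cvgM; first exact: cvg_snd.
    apply: (@cvg_comp _ _ _ fst c (nbhs (x, t)) (nbhs x)); first exact: cvg_fst.
    exact: cc.
  have [cx0 cxr] := c0 x Xx; have /andP[x0 xr] := Xr x Xx.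
  rewrite in_itv/= => /andP[t0 t1].
  have k0 : 0 < (1 - t) + t * c x.
    have [->|tn1] := eqVneq t 1; first by rewrite subrr add0r mul1r.
    by rewrite ltr_wpDr ?mulr_ge0 ?(ltW cx0)// subr_gt0 lt_neqAle tn1.
  rewrite /punctured_disc/= norm_scale_pos ?(ltW k0)// mulr_gt0//= mulrDl -mulrA.
  have -> : r = (1 - t) * r + t * r by rewrite -mulrDl subrK mul1r.
  apply: lerD.
    by rewrite ler_wpM2l// subr_ge0.
  by rewrite ler_wpM2l.
- by move=> x _ /=; rewrite subr0 mul0r addr0 scale1r.
- by move=> x _ /=; rewrite subrr add0r mul1r.
Qed.

(** The embedded sphere [e (r x)] need not be a homotopy inverse of [radial], as
    [e] may reverse orientation, and a round sphere need not lie in [Q].  So one takes a round sphere so small that it lies in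
    [B], the image of the punctured disc, and pushes it into [Q] by the
    retraction [q] of [B] onto [Q] that [e] transports from the round annulus.
    - [radial] after this map is homotopic to the identity because [q] is
      homotopic to the identity inside [B], where [radial] is defined.
    - In the other order, it suffices to deform the rescaling [sh] of [Q] to the
      small round sphere into the identity within [B], and then apply [q].  For
      this, shrink [Q] along the embedded radii until it lies in a round disc
      contained in [B]; there [sh] is deformed to the identity along the
      straight radii; then expand again along the embedded radii. *)
Lemma embedded_annulus_equivalence s r (e e' : V -> V) :
  0 < s <= r ->
  inverse_homeos (disc r) (e @` disc r) e e' -> e 0 = 0 ->
  nbhs (0 : V) (e @` disc r) ->
  let Q := e @` annulus s r in
  exists g, [/\ is_map cube_sphere Q g,
    homotopic R cube_sphere cube_sphere (radial \o g) id &
    homotopic R Q Q (g \o radial) id].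
Proof.
move=> /andP[s0 sr] [em e'm eK e'K] e0 nB Q.
have r0 : 0 < r by exact: lt_le_trans s0 sr.
have Pdisc : punctured_disc r `<=` disc r by move=> x /andP[].
have Apunct : annulus s r `<=` punctured_disc r.
  by move=> x /andP[sx xr]; rewrite /punctured_disc/= xr andbT (lt_le_trans s0).
pose B := e @` punctured_disc r.
have B0 y : B y -> 0 < `|y|.
  move=> [x /[dup] /Pdisc xr /andP[x0 _] <-]; rewrite normr_gt0.
  apply: contraTneq x0 => ex0; rewrite -(eK x xr) ex0 -e0 eK//.
    by rewrite normr0 ltxx.
  by rewrite /disc/= normr0 ltW.
have eB : is_map (punctured_disc r) B e.
  split; first exact: continuous_subspaceW em.1.
  by move=> x xr; exists x.
have e'B : is_map B (punctured_disc r) e'.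
  split; first by apply: continuous_subspaceW e'm.1; apply: image_subset.
  by move=> y [x xr <-]; rewrite eK//; exact: Pdisc.
(* [a] pushes the inner part of the punctured disc out to the annulus *)
pose c x := Num.max `|x| s / `|x|; pose a x := c x *: x.
have ccont x : punctured_disc r x -> {for x, continuous c}.
  move=> /andP[x0 _]; apply: continuousM; last exact: continuous_norm_inv.
  by apply: continuous_max; [exact: norm_continuous|exact: cst_continuous].
have cgt0 x : 0 < `|x| -> 0 < c x by move=> x0; rewrite divr_gt0// lt_max x0.
have cnorm x : 0 < `|x| -> c x * `|x| = Num.max `|x| s.
  by move=> x0; rewrite divfK// gt_eqF.
have am : is_map (punctured_disc r) (annulus s r) a.
  apply: continuous_is_map => [x xr|x /andP[x0 xr]].
    by apply: continuousZ; [exact: ccont|exact: cvg_id].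
  rewrite /annulus/= norm_scale_pos ?(ltW (cgt0 _ x0))// cnorm// le_max lexx orbT/=.
  by rewrite ge_max xr.
have aid x : annulus s r x -> a x = x.
  move=> /andP[sx xr]; rewrite /a /c max_l// mulfV ?scale1r//.
  by rewrite gt_eqF// (lt_le_trans s0).
have a_id : homotopic R (punctured_disc r) (punctured_disc r) id a.
  apply: scaling_homotopy => // x /andP[x0 xr]; split; first exact: cgt0.
  by rewrite cnorm// ge_max xr.
pose q := e \o a \o e'.
have eQ : is_map (annulus s r) Q e.
  split; last by move=> x xA; exists x.
  by apply: continuous_subspaceW em.1; apply: subset_trans Apunct Pdisc.
have qm : is_map B Q q by apply: is_map_comp eQ; apply: is_map_comp e'B am.
have QB : Q `<=` B by apply: image_subset.
have qid y : Q y -> q y = y.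
  move=> [x xA <-]; rewrite /q/= eK ?aid//.
  by apply: Pdisc; apply: Apunct.
have q_id : homotopic R B B id q.
  apply: (homotopic_eq _ _ (homotopic_post (homotopic_pre e'B a_id) eB)) => //.
  by move=> y By /=; rewrite e'K//; apply: image_subset By.
(* [t] is the radius of a round disc inside the embedded one, and [u] that of a
   disc which [e] sends into it *)
have [/= t t0 tB] : exists2 t, 0 < t & punctured_disc t `<=` B.
  have /nbhs_ballP[t /= t0 tB] := nB.
  exists (t / 2); first exact: divr_gt0.
  move=> y /andP[y0 yt]; have [|x xr exy] := tB y.
    rewrite -ball_normE/= sub0r normrN (le_lt_trans yt)//.
    by rewrite ltr_pdivrMr// ltr_pMr// ltr1n.
  exists x => //; rewrite /punctured_disc/= xr andbT normr_gt0.
  by apply: contraTneq y0 => x0; rewrite -exy x0 e0 normr0 ltxx.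
have [/= u /andP[u0 ur] ut] : exists2 u, 0 < u <= r &
    forall x, 0 < `|x| <= u -> punctured_disc t (e x).
  have d0 : disc r 0 by rewrite /disc/= normr0 ltW.
  move: em => [/within_continuousE/(_ 0 d0 (ball 0 t))]; rewrite e0.
  move=> /(_ (nbhsx_ballx _ _ t0)) /nbhs_ballP[u /= u0 ut] _.
  exists (Num.min (u / 2) r); first by rewrite lt_min divr_gt0//= r0 ge_min lexx orbT.
  move=> x /andP[x0]; rewrite le_min => /andP[xu xr].
  have Bex : B (e x) by exists x => //; rewrite /punctured_disc/= x0.
  rewrite /punctured_disc/= B0//=.
  have := ut x; rewrite -!ball_normE/= !sub0r !normrN => /(_ _ xr) /ltW; apply.
  by rewrite (le_lt_trans xu)// ltr_pdivrMr// ltr_pMr// ltr1n.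
pose sh x : V := t *: radial x.
have shm X : (forall x, X x -> 0 < `|x|) -> is_map X (punctured_disc t) sh.
  move=> X0; apply: continuous_is_map => [x /X0 x0|x /X0 x0].
    apply: continuousZ; first exact: cst_continuous.
    by apply: continuousZ; [exact: continuous_norm_inv|exact: cvg_id].
  by rewrite /punctured_disc/= norm_scale_pos ?(ltW t0)// norm_radial// mulr1 t0/=.
have shB X : (forall x, X x -> 0 < `|x|) -> is_map X B sh.
  by move=> X0; apply: is_map_sub (shm X X0).
have S0 x : cube_sphere x -> 0 < `|x| by move=> ->; rewrite ltr01.
have radB : is_map B cube_sphere radial by exact: radial_is_map.
exists (q \o sh); split.
- exact: is_map_comp (shB _ S0) qm.
- apply: homotopic_sym.
  apply: homotopic_eq (homotopic_pre (shB _ S0) (homotopic_post q_id radB)) => //.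
  move=> x x1 /=; have x0 := S0 x x1.
  rewrite /sh /radial norm_scale_pos ?(ltW t0)// norm_scale_pos ?invr_ge0// mulVf ?gt_eqF//.
  by rewrite mulr1 x1 invr1 scale1r scalerA mulVf ?scale1r// gt_eqF.
- have Qcl : closed Q.
    apply: compact_closed; first exact: norm_hausdorff.
    apply: continuous_compact (@compact_annulus s r).
    exact: eQ.1.
  (* [v] shrinks [Q] along the embedded radii into a round disc inside [B] *)
  pose b x := (u / `|x|) *: x; pose v := e \o b \o e'.
  have e'A : is_map Q (annulus s r) e'.
    split; first by apply: continuous_subspaceW e'B.1.
    by move=> y [x xA <-]; rewrite eK//; apply: Pdisc; apply: Apunct.
  have bh : homotopic R (annulus s r) (punctured_disc r) id b.
    apply: scaling_homotopy => // x /Apunct /andP[x0 xr].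
      by apply: continuousM; [exact: cst_continuous|exact: continuous_norm_inv].
    by rewrite divr_gt0// divfK ?gt_eqF.
  have vh : homotopic R Q B id v.
    apply: (homotopic_eq _ _ (homotopic_post (homotopic_pre e'A bh) eB)) => //.
    by move=> y By /=; rewrite e'K//; case: By => x xA <-;
      exists x => //; apply: Pdisc; apply: Apunct.
  have vm : is_map Q (punctured_disc t) v.
    split; first exact: (homotopic_is_map vh).1.
    move=> y /e'A.2 /Apunct /andP[y0 yr]; apply: ut.
    rewrite /b norm_scale_pos ?divr_ge0// ?(ltW u0)// divfK ?gt_eqF//.
    by rewrite u0/=.
  have sh_id : homotopic R (punctured_disc t) (punctured_disc t) id sh.
    apply: homotopic_eq (@scaling_homotopy (punctured_disc t) t (fun x => t / `|x|) _ _ _) => //.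
    - by move=> x _; rewrite /sh /radial scalerA.
    - move=> x /andP[x0 _]; apply: continuousM; [exact: cst_continuous|exact: continuous_norm_inv].
    - by move=> x /andP[x0 _]; rewrite divr_gt0// divfK ?gt_eqF.
  have step1 : homotopic R Q B sh (sh \o v).
    exact: homotopic_post vh (shB _ B0).
  have step2 : homotopic R Q B (sh \o v) v.
    apply: homotopic_sym; apply: homotopic_sub (homotopic_pre vm sh_id) => //.
  have step : homotopic R Q B sh id.
    apply: homotopic_trans step1 _ => //.
    by apply: homotopic_trans step2 _ => //; exact: homotopic_sym.
  apply: homotopic_eq (homotopic_post step qm).
  + move=> x Qx; have x0 := B0 _ (QB _ Qx).
    rewrite /= /sh /radial norm_scale_pos ?invr_ge0// mulVf ?gt_eqF//.
    by rewrite invr1 scale1r.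
  + by move=> x Qx /=; rewrite qid.
Qed.

End Annuli.

(** * Polyhedra *)

Section Boxes.
Context {R : realType} {n : nat}.
Notation V := 'rV[R]_n.
Implicit Types (a b x : V).

Definition box a b : set V := [set x | forall i, a ord0 i <= x ord0 i <= b ord0 i].

Definition box_vertex a b (v : {ffun 'I_n -> bool}) : V :=
  \row_i (if v i then b ord0 i else a ord0 i).

Definition box_vertices a b : seq V :=
  [seq box_vertex a b v | v <- enum {ffun 'I_n -> bool}].

Lemma convex_hull_image (I : finType) (i0 : I) (p : I -> V) (w : I -> R) :
  (forall i, 0 <= w i) -> \sum_i w i = 1 ->
  convex_hull [seq p i | i <- enum I] (\sum_i w i *: p i).
Proof.
move=> w0 w1; exists (fun k => w (nth i0 (enum I) k)); split.
- by move=> k.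
- rewrite size_map -(big_mkord xpredT (fun k => w (nth i0 (enum I) k))).
  by rewrite -(big_nth i0 xpredT) big_enum.
- rewrite -(big_mkord xpredT
    (fun k => w (nth i0 (enum I) k) *: nth 0 [seq p i | i <- enum I] k)) size_map.
  rewrite -[LHS]big_enum/= (big_nth i0); apply: eq_big_nat => k /andP[_ kI].
  by rewrite (nth_map i0).
Qed.

(** If [x] divides the [i]-th side in the ratio [t i], the product weights
    [\prod_i (t i or 1 - t i)] express [x] through the vertices; their sums are
    computed by distributing the product over the two choices in each
    coordinate.  Sides of length zero are allowed, so that faces of a box are
    boxes. *)
Lemma box_convex_hull a b : (forall i, a ord0 i <= b ord0 i) ->
  box a b = convex_hull (box_vertices a b).
Proof.
move=> ab; apply/seteqP; split => [x xab|x [w [w0 w1 ->]] j].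
  pose d i := b ord0 i - a ord0 i.
  pose t i := (x ord0 i - a ord0 i) / d i.
  have d0 i : 0 <= d i by rewrite subr_ge0.
  have t01 i : 0 <= t i <= 1.
    have /andP[ax xb] := xab i.
    rewrite /t divr_ge0 ?subr_ge0//=; have [->|dn0] := eqVneq (d i) 0.
      by rewrite invr0 mulr0.
    by rewrite ler_pdivrMr ?mul1r ?lerB// lt_neqAle eq_sym dn0 d0.
  have xt i : x ord0 i = (1 - t i) * a ord0 i + t i * b ord0 i.
    have -> : (1 - t i) * a ord0 i + t i * b ord0 i = a ord0 i + t i * d i.
      by rewrite mulrBl mul1r mulrBr addrAC addrA.
    have [di0|dn0] := eqVneq (d i) 0; last by rewrite divfK// addrC subrK.
    rewrite di0 mulr0 addr0; apply/eqP; rewrite eq_le.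
    have /andP[-> xb] := xab i; rewrite andbT (le_trans xb)//.
    by rewrite -subr_le0 -/(d i) di0.
  pose F i (c : bool) := if c then t i else 1 - t i.
  pose w (v : {ffun 'I_n -> bool}) := \prod_i F i (v i).
  have wdistr (G : 'I_n -> bool -> R) :
      \sum_(v : {ffun 'I_n -> bool}) \prod_i G i (v i) = \prod_i (G i true + G i false).
    rewrite -bigA_distr_bigA; apply: eq_bigr => i _.
    by rewrite big_bool.
  have -> : x = \sum_v w v *: box_vertex a b v.
    apply/rowP => j; rewrite summxE.
    pose G i c := F i c * (if i == j then (if c then b ord0 i else a ord0 i) else 1).
    rewrite (eq_bigr (fun v : {ffun 'I_n -> bool} => \prod_i G i (v i))).
      rewrite wdistr (bigD1 j)//= big1 ?mulr1.
        by rewrite /G eqxx/= addrC -xt.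
      by move=> i /negbTE ij; rewrite /G ij !mulr1 /F addrC subrK.
    move=> v _; rewrite !mxE big_split/=; congr (_ * _).
    by rewrite -big_mkcond/= big_pred1_eq.
  apply: convex_hull_image; first exact: [ffun=> true].
    move=> v; apply: prodr_ge0 => i _; rewrite /F.
    by have /andP[t0 t1] := t01 i; case: ifP => // _; rewrite subr_ge0.
  by rewrite wdistr big1// => i _; rewrite /F addrC subrK.
have vbox (k : 'I_(size (box_vertices a b))) : box a b (box_vertices a b)`_k.
  have /mapP[v _ ->] := mem_nth 0 (ltn_ord k).
  by move=> i; rewrite mxE; case: ifP; rewrite lexx ab.
rewrite summxE -[a ord0 j]mul1r -[b ord0 j]mul1r -w1 !mulr_suml.
apply/andP; split; apply: ler_sum => k _; rewrite mxE ler_wpM2l//;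
by have /andP[] := vbox k j.
Qed.

Lemma polyhedron_boxes (s : seq (V * V)) :
  (forall c, c \in s -> forall i, c.1 ord0 i <= c.2 ord0 i) ->
  compact_polyhedron (\bigcup_(c in [set` s]) box c.1 c.2).
Proof.
move=> sab; exists [seq box_vertices c.1 c.2 | c <- s].
apply/seteqP; split => x.
  move=> [c /= cs]; rewrite box_convex_hull; last exact: sab.
  by move=> cx; exists (box_vertices c.1 c.2) => //=; exact: map_f.
move=> [_ /= /mapP[c cs ->]]; rewrite -box_convex_hull; last exact: sab.
by move=> cx; exists c.
Qed.

Lemma norm_leP x r : 0 <= r -> (`|x| <= r) <-> forall i, `|x ord0 i| <= r.
Proof.
move=> r0; have -> : `|x| = mx_norm x by [].
rewrite mx_normrE; split => [/bigmax_leP[_ xr] i|xr].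
  exact: (xr (ord0, i)).
by apply/bigmax_leP; split => // -[i j] _; rewrite ord1.
Qed.

(** The faces of the cube are the degenerate boxes obtained by fixing one
    coordinate to 1 or -1. *)
Lemma cube_sphere_polyhedron : compact_polyhedron (@cube_sphere R n).
Proof.
pose sg (c : bool) : R := if c then 1 else -1.
pose fc (k : 'I_n * bool) (u : R) : V := \row_i (if i == k.1 then sg k.2 else u).
pose s := [seq (fc k (-1), fc k 1) | k <- enum {: 'I_n * bool}].
have -> : @cube_sphere R n = \bigcup_(c in [set` s]) box c.1 c.2.
  apply/seteqP; split => x.
    move=> x1; have : mx_norm x != 0 by rewrite -[mx_norm x]/`|x| x1 oner_eq0.
    move=> /mx_norm_neq0[[i j]]; rewrite -[mx_norm x]/`|x| x1 (ord1 i)/= => xj.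
    exists (fc (j, 0 <= x ord0 j) (-1), fc (j, 0 <= x ord0 j) 1).
      by apply/mapP; exists (j, 0 <= x ord0 j); rewrite ?mem_enum.
    move=> k /=; rewrite !mxE/=; case: eqP => [->|_].
      rewrite /sg; case: ifPn => x0; first by rewrite xj ger0_norm ?lexx.
      by rewrite xj ltr0_norm ?opprK ?lexx// ltNge.
    have : `|x ord0 k| <= 1 by move: k; apply/norm_leP => //; rewrite x1.
    by rewrite ler_norml.
  move=> [_ /= /mapP[[j c] _ ->]] xb.
  have xj : `|x ord0 j| = 1.
    have := xb j; rewrite !mxE/= eqxx -eq_le => /eqP <-.
    by rewrite /sg; case: c {xb}; rewrite ?normrN normr1.
  apply/eqP; rewrite eq_le; apply/andP; split.
    apply/norm_leP => // i; have := xb i; rewrite !mxE/=.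
    by case: eqP => [->|_]; [rewrite xj|rewrite ler_norml].
  by rewrite -xj; move: j {xb xj} => j; move: j; apply/norm_leP.
apply: polyhedron_boxes => c /mapP[k _ ->] i; rewrite !mxE.
by case: ifP => // _; rewrite lerNl opprK ler1n.
Qed.

Lemma closed_ball_box x r : 0 <= r ->
  [set y | `|x - y| <= r] = box (x - const_mx r) (x + const_mx r).
Proof.
move=> r0; apply/seteqP; split => y /=.
  move=> /norm_leP -/(_ r0) xy i; have := xy i; rewrite !mxE distrC ler_distl.
  by [].
move=> xy; apply/norm_leP => // i; have := xy i; rewrite !mxE distrC ler_distl.
by [].
Qed.

Lemma polyhedral_neighborhood (K G : set V) : compact K -> open G -> K `<=` G ->
  exists P, [/\ compact_polyhedron P, K `<=` P° & P `<=` G].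
Proof.
move=> Kc Go KG.
have : forall x, exists r, 0 < r /\ (K x -> [set y | `|x - y| <= r] `<=` G).
  move=> x; have [Kx|nKx] := pselect (K x); last by exists 1.
  have /nbhs_ballP[r /= r0 rG] := open_nbhs_nbhs (conj Go (KG _ Kx)).
  exists (r / 2); split; first exact: divr_gt0.
  move=> _ y /= xy; apply: rG; rewrite -ball_normE/= (le_lt_trans xy)//.
  by rewrite ltr_pdivrMr// ltr_pMr// ltr1n.
move=> /choice[r rP].
have := Kc; rewrite compact_cover => /(_ _ K (fun x => ball x (r x))).
case.
- by move=> x _; exact: ball_open.
- by move=> x Kx; exists x => //; exact: ballxx (rP x).1.
move=> D DK KD.
exists (\bigcup_(c in [set` [seq (x - const_mx (r x), x + const_mx (r x)) | x <- finmap.enum_fset D]]) box c.1 c.2).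
split.
- apply: polyhedron_boxes => c /mapP[x _ ->] i; rewrite !mxE.
  by rewrite lerD2l ge0_cp// ltW// (rP x).1.
- move=> y /KD [x /= xD xy].
  apply: filterS (open_nbhs_nbhs (conj (ball_open x (r x)) xy)) => z xz.
  exists (x - const_mx (r x), x + const_mx (r x)); first exact: (map_f (fun x => (x - const_mx (r x), x + const_mx (r x)))).
  rewrite -closed_ball_box/=; last exact: ltW (rP x).1.
  by move: xz; rewrite -ball_normE/= => /ltW.
- move=> y [_ /= /mapP[x xD ->]]; rewrite -closed_ball_box/=; last exact: ltW (rP x).1.
  by apply: (rP x).2; exact/set_mem/DK.
Qed.

(** Take each member inside the interior of the previous one and, at stage [j],
    within distance [1/(j+1)] of [K]. *)
Lemma polyhedral_basis (K G : set V) : compact K -> open G -> K `<=` G ->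
  exists P : nat -> set V, [/\ forall j, compact_polyhedron (P j),
    forall j, K `<=` (P j)°, forall i j, (i <= j)%N -> P j `<=` P i,
    P 0%N `<=` G &
    forall U, open U -> K `<=` U -> exists j, P j `<=` U].
Proof.
move=> Kc Go KG.
have : forall U : set V, exists P, open U -> K `<=` U ->
    [/\ compact_polyhedron P, K `<=` P° & P `<=` U].
  move=> U; have [Uo|nU] := pselect (open U); last by exists set0.
  have [KU|nKU] := pselect (K `<=` U); last by exists set0.
  by have [P ?] := polyhedral_neighborhood Kc Uo KU; exists P.
move=> /choice[F FP].
pose thick j : set V := \bigcup_(x in K) ball x (j.+1%:R^-1).
have thick_open j : open (thick j).
  by apply: bigcup_open => x _; exact: ball_open.
have Kthick j : K `<=` thick j.
  by move=> x Kx; exists x => //; apply: ballxx; rewrite invr_gt0.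
pose P := fix P j := if j is j'.+1 then F ((P j')° `&` thick j') else F G.
have KP j : K `<=` (P j)°.
  elim: j => [|j ih]; first by have [] := FP G Go KG.
  have [] // := FP ((P j)° `&` thick j).
    by apply: openI => //; exact: open_interior.
  by move=> x Kx; split; [exact: ih|exact: Kthick].
have step j : compact_polyhedron (P j.+1) /\ P j.+1 `<=` (P j)° `&` thick j.
  have [] // := FP ((P j)° `&` thick j).
    by apply: openI => //; exact: open_interior.
  by move=> x Kx; split; [exact: KP|exact: Kthick].
exists P; split => //.
- by case=> [|j]; [have [] := FP G Go KG|exact: (step j).1].
- move=> i j /subnK <-; elim: (j - i)%N => [|k ih]//.
  apply: subset_trans ih; rewrite addSn => x /(step _).2[Px _].
  exact: nbhs_singleton.
- by have [] := FP G Go KG.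
move=> U Uo KU.
have [e e0 eU] := lebesgue_number Kc Uo KU.
have [j _ /(_ j (leqnn j)) je] := near_infty_natSinv_lt (PosNum e0).
exists j.+1 => y /(step j).2 [_ [x Kx xy]].
by apply: (eU x Kx); exact: le_ball (ltW je) y xy.
Qed.

End Boxes.

(** * Nested sequences and shape *)

(** Stated for an arbitrary space: for row vectors the neighborhood filter would
    unfold to the entrywise one. *)
Lemma diagonal_continuous (T : topologicalType) :
  continuous ((fun x _ => x) : T -> prod_topology (fun _ : nat => T)).
Proof.
move=> x; apply/cvg_sup => i U [W [[D oD <-] Dx DU]].
by apply: filterS (open_nbhs_nbhs (conj oD Dx)) => y Dy; apply: DU.
Qed.

Section NestedSequences.
Context {R : realType} {n : nat}.
Notation V := 'rV[R]_n.

Section Sequence.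
Context (P : nat -> set V) (P_polyhedron : forall i, compact_polyhedron (P i))
  (P_nested : forall i j, (i <= j)%N -> P j `<=` P i).

Definition nested_sequence : inverse_sequence R.
Proof.
apply: (@InverseSequence R (fun=> n) P (fun _ _ => id)) => //.
by move=> i j ij; apply: is_map_id; exact: P_nested.
Defined.

Lemma nested_limit : homeomorphic (\bigcap_i P i) (inverse_limit nested_sequence).
Proof.
exists (fun x _ => x), (fun x => x 0%N); split.
- apply: continuous_is_map => [x _|x Px]; first exact: diagonal_continuous.
  by split => // i; exact: Px.
- apply: continuous_is_map => [x _|x [Px xx] i _].
    exact: (@proj_continuous _ (fun _ : nat => V) 0%N).
  by have /= := xx 0%N i (leq0n i) => <-; exact: Px.
- by [].
- move=> x [Px xx]; apply: functional_extensionality_dep => i.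
  by have /= := xx 0%N i (leq0n i) => ->.
Qed.

End Sequence.

(** The maps [g] are automatically compatible: for [i] large, [g i] is homotopic
    to [g j \o h \o g i] in [P j], because [g j \o h] is homotopic to the
    inclusion, and the latter to [g j], because [h \o g i] is homotopic to the
    identity.  So two inverses up to homotopy at every stage are all that is
    needed. *)
Lemma nested_pro_isomorphic (P : nat -> set V) (S : set V)
    (Pp : forall i, compact_polyhedron (P i))
    (Pn : forall i j, (i <= j)%N -> P j `<=` P i)
    (Sp : forall i : nat, compact_polyhedron S)
    (Sn : forall i j : nat, (i <= j)%N -> S `<=` S) (h : V -> V) :
  closed S -> is_map (P 0%N) S h ->
  (forall j, exists (g : V -> V) (i : nat), [/\ (j <= i)%N, is_map S (P j) g,
     homotopic R S S (h \o g) id & homotopic R (P i) (P j) (g \o h) id]) ->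
  pro_isomorphic (nested_sequence Pp Pn) (nested_sequence Sp Sn).
Proof.
move=> Scl hm /choice[g] /choice[m gP].
have gm j : is_map S (P j) (g j) by have [] := gP j.
have g_stable j i : (m j <= i)%N -> homotopic R S (P j) (g i) (g j).
  move=> mi; have [jm _ _ ghj] := gP j; have [_ _ hgi _] := gP i.
  have gim : is_map S (P (m j)) (g i) by apply: is_map_sub (gm i) => //; exact: Pn.
  apply: homotopic_trans (homotopic_sym (homotopic_pre gim ghj)) _ => //.
  exact: homotopic_post hgi (gm j).
exists (@ProMap R (nested_sequence Pp Pn) (nested_sequence Sp Sn) (fun=> 0%N) (fun=> h)).
exists (@ProMap R (nested_sequence Sp Sn) (nested_sequence Pp Pn) id g).
split.
- split=> // j j' _; exists 0%N; split => //.
  exact: homotopic_refl hm _.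
- split=> // j j' jj'; exists (maxn j j'); rewrite leq_maxl leq_maxr; split => //=.
  pose i := maxn (m j) (m j').
  have ij := g_stable j i (leq_maxl _ _).
  have ij' := g_stable j' i (leq_maxr _ _).
  apply: homotopic_trans (homotopic_sym ij) _ => //.
  by apply: homotopic_sub ij' => //; exact: Pn.
- move=> j; have [jm _ _ ghj] := gP j; exists (m j); split => //.
- move=> j; have [_ _ hg _] := gP 0%N; exists j; split => //.
Qed.

End NestedSequences.

Section Sphere.
Context {R : realType} {n : nat}.
Notation V := 'rV[R]_n.

Let sumsq (x : V) : R := \sum_(i < n) x ord0 i ^+ 2.

Lemma sumsq_scale c x : sumsq (c *: x) = c ^+ 2 * sumsq x.
Proof. by rewrite mulr_sumr; apply: eq_bigr => i _; rewrite mxE exprMn. Qed.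

Lemma sumsq_gt0 x : 0 < `|x| -> 0 < sumsq x.
Proof.
move=> x0; have s0 : 0 <= sumsq x by apply: sumr_ge0 => i _; exact: sqr_ge0.
rewrite lt_neqAle s0 andbT eq_sym; apply: contraTneq x0 => sx0.
suff -> : x = 0 by rewrite normr0 ltxx.
apply/rowP => i; rewrite mxE; apply/eqP.
have /eqP := psumr_eq0P (fun i _ => sqr_ge0 (x ord0 i)) sx0 (i := i) isT.
by rewrite sqrf_eq0.
Qed.

Lemma continuous_sumsq : continuous sumsq.
Proof.
apply: continuous_big => [|i _ x]; first exact: add_continuous.
by apply: continuousM; exact: coord_continuous.
Qed.

Lemma sphere_cube_sphere : homeomorphic (@sphere R n) (@cube_sphere R n).
Proof.
have sph0 (x : V) : @sphere R n x -> 0 < `|x|.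
  move=> x1; rewrite normr_gt0; apply: contra_eq_neq x1 => ->.
  rewrite big1 ?[0 == 1]eq_sym ?oner_eq0// => i _.
  by rewrite mxE expr0n.
have cub0 (x : V) : cube_sphere x -> 0 < `|x| by move=> ->; exact: ltr01.
exists radial, (fun x => (Num.sqrt (sumsq x))^-1 *: x); split.
- exact: radial_is_map.
- apply: continuous_is_map => x /cub0 x0.
    apply: continuousZ; last exact: cvg_id.
    apply: continuousV; first by rewrite gt_eqF// sqrtr_gt0 sumsq_gt0.
    apply: continuous_comp; first exact: continuous_sumsq.
    exact: sqrt_continuous.
  have s0 := sumsq_gt0 x0.
  by rewrite /sphere/= -/(sumsq _) sumsq_scale exprVn sqr_sqrtr ?(ltW s0)// mulVf// gt_eqF.
- move=> x /[dup] x1 /sph0 x0.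
  rewrite /radial sumsq_scale -/(sumsq x) (_ : sumsq x = 1)// mulr1 sqrtr_sqr.
  by rewrite ger0_norm ?invr_ge0// invrK scalerA mulfV ?scale1r// gt_eqF.
- move=> x /[dup] x1 /cub0 x0.
  have r0 : 0 < (Num.sqrt (sumsq x)) by rewrite sqrtr_gt0 sumsq_gt0.
  rewrite /radial norm_scale_pos ?invr_ge0 ?(ltW r0)// x1 mulr1 invrK scalerA mulfV ?scale1r//.
  by rewrite gt_eqF.
Qed.

(** Between a polyhedral neighborhood [P j] of [K] and a later one [P i] there is
    an embedded annulus [Q]; the homotopy inverse of [radial] on [Q] serves as
    the map from the sphere to [P j]. *)
Lemma nested_annuli_shape (T : topologicalType) (A : set T) (K : set V) :
  homeomorphic A K -> compact K ->
  (forall G, open G -> K `<=` G -> exists (s r : R) (e e' : V -> V),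
    [/\ 0 < s <= r, inverse_homeos (disc r) (e @` disc r) e e',
        e 0 = 0 /\ nbhs (0 : V) (e @` disc r),
        K `<=` (e @` annulus s r)° & e @` annulus s r `<=` G]) ->
  same_shape R A (@sphere R n).
Proof.
move=> AK Kc Kann.
have Kn0 : K `<=` [set x | 0 < `|x|].
  have [//|s [r [e [e' [/andP[s0 sr] [_ _ eK _] [e0 _] Ke _]]]]] := Kann setT openT.
  move=> x /Ke /nbhs_singleton [y /andP[sy yr] <-] /=; rewrite normr_gt0.
  apply: contraTneq s0 => ey0; rewrite -leNgt (le_trans sy)//.
  rewrite -(eK y yr) ey0 -e0 eK ?normr0//.
  by rewrite /disc/= normr0 (le_trans _ yr).
have On0 : open [set x : V | 0 < `|x|].
  apply: (@open_comp V R (fun x => `|x|) [set t | 0 < t]); last exact: open_gt.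
  by move=> x _; exact: norm_continuous.
have [P [Pp KP Pn P0 Pbasis]] := polyhedral_basis Kc On0 Kn0.
have Sp (i : nat) := @cube_sphere_polyhedron R n.
have Sn (i j : nat) (_ : (i <= j)%N) := @subset_refl _ (@cube_sphere R n).
exists (nested_sequence Pp Pn), (nested_sequence Sp Sn); split.
- apply: homeomorphic_trans AK _.
  suff -> : K = \bigcap_i P i by exact: nested_limit.
  apply/seteqP; split => [x Kx i _|x Px]; first exact: nbhs_singleton (KP i x Kx).
  apply: contrapT => nKx.
  have Kx : K `<=` ~` [set x] by move=> y Ky /= yx; apply: nKx; rewrite -yx.
  have [] := Pbasis (~` [set x]) _ Kx.
    rewrite openC; apply: compact_closed; first exact: norm_hausdorff.
    exact: compact_set1.
  by move=> j /(_ x (Px j I)); apply.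
- apply: homeomorphic_trans sphere_cube_sphere _.
  suff {2}-> : @cube_sphere R n = \bigcap_(i : nat) (@cube_sphere R n) by exact: nested_limit.
  by apply/seteqP; split => [x Sx i _//|x /(_ 0%N I)].
- apply: (@nested_pro_isomorphic _ _ P (@cube_sphere R n) Pp Pn Sp Sn radial).
  + exact: closed_cube_sphere.
  + by apply: radial_is_map => x /P0.
  move=> j; have [] := Kann (P j)°.
  + exact: open_interior.
  + exact: KP.
  move=> s [r [e [e' [sr eh [e0 B0] Ke eP]]]].
  have [g [gm hg gh]] := embedded_annulus_equivalence sr eh e0 B0.
  have [i iP] := Pbasis _ (@open_interior _ _) Ke.
  have QPj : e @` annulus s r `<=` P j by move=> x /eP; exact: nbhs_singleton.
  exists g, (maxn i j); split => //.
  + exact: leq_maxr.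
  + exact: is_map_sub gm.
  + apply: homotopic_sub gh => // x xP; apply: nbhs_singleton; apply: iP.
    exact: Pn (leq_maxl i j) _ xP.
Qed.

End Sphere.

(** * Omega-limits and attraction *)

Section Attraction.
Context {T : topologicalType}.
Implicit Types (X K W : set T) (f : T -> T).

Lemma attractor_fixpoint X f p :
  is_map X X f -> attractor X f [set p] -> f p = p.
Proof.
move=> fm [_ pX [W _ Wp]]; have [/within_continuousE fc fX] := fm.
have Xp : X p by exact: pX.
have om : omega_limit X f (W `&` X) p by rewrite -Wp.
suff : [set p] (f p) by [].
rewrite Wp => n /= n0; split; first exact: fX.
move=> U /(fc p Xp) Ufp; have [_ /(_ _ Ufp)] := om n n0.
move=> [y [[k /= nk [x [Wx Xx] <-]] Uy]].
exists (iter k.+1 f x); split; last first.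
  by apply: Uy; exact: (is_map_iter k fm).2.
by exists k.+1 => /=; [exact: leqW|exists x].
Qed.

(** The omega-limit of [W] being [{p}] does not by itself keep orbits near [p]:
    they might escape where [W] is not compact.  But a compact set missing [p]
    is missed by all late images of [W] ([escape]).  Let [A0] be the points near
    [p] whose image is still in the compact neighborhood [C].  Late orbit points
    avoid [C `\` A0], so once in [A0] an orbit passes to [C] and hence to [A0]
    again: it is confined to [C] forever, where [escape] forces it into every
    neighborhood of [p]. *)
Lemma attraction_to_point X f p C G0 :
  hausdorff_space T -> is_map X X f -> attractor X f [set p] ->
  compact C -> C `<=` X -> nbhs p G0 -> G0 `&` X `<=` C ->
  exists2 E, nbhs p E & forall G, nbhs p G ->
    \forall j \near \oo, forall x, E x -> X x -> G (iter j f x).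
Proof.
move=> hT fm fatt Cc CX G0p G0C.
have fp := attractor_fixpoint fm fatt.
have [_ pX [W Wnbhs Wp]] := fatt; have Xp : X p by exact: pX.
have [fc fX] := fm; move/within_continuousE in fc.
have iX k x : X x -> X (iter k f x) by exact: (is_map_iter k fm).2.
have escape L : compact L -> L `<=` X -> ~ L p ->
    \forall j \near \oo, forall k x, (j <= k)%N -> W x -> X x -> ~ L (iter k f x).
  move=> Lc LX Lp.
  have : \forall j \near \oo,
      L `<=` (fun y => forall k x, (j <= k)%N -> W x -> X x -> iter k f x <> y).
    apply: (compact_near_coveringP L).1 => // y Ly.
    have : ~ omega_limit X f (W `&` X) y by rewrite -Wp => yp; apply: Lp; rewrite -yp.
    move=> /existsNP[n /not_implyP[/= n0 /not_andP[|ncl]]]; first by move/(_ (LX _ Ly)).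
    move: ncl => /existsNP[B /not_implyP[By nB]].
    exists (B, [set i | (n <= i)%N]) => /=; first by split=> //; exact: nbhs_infty_ge.
    move=> [y' i] [/= By' ni] k x ik Wx Xx kxy; apply: nB; exists y'; split => //.
    by exists k => /=; [exact: leq_trans ni ik|exists x].
  by apply: filterS => j jP k x jk Wx Xx Lx; exact: (jP _ Lx k x).
have nbhs_f (k : nat) U : nbhs p U -> \forall x \near p, X x -> U (iter k f x).
  move=> pU; have [/within_continuousE ic _] := is_map_iter k fm.
  by apply: ic => //; rewrite iter_fix.
have [A0 [A0o A0p A0G]] : exists A0, [/\ open A0, A0 p &
    forall x, A0 x -> G0 x /\ (X x -> G0 (f x))].
  have : nbhs p (G0 `&` [set x | X x -> G0 (f x)]).
    exact: filterI G0p (nbhs_f 1%N _ G0p).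
  by rewrite nbhsE => -[A0 [A0o A0p] A0G]; exists A0; split.
have sub_closed A : open A -> compact (C `\` A).
  by move=> Ao; apply: compact_closedI => //; exact: open_closedC.
have [n _ /(_ n (leqnn n)) nA0] : \forall j \near \oo,
    forall k x, (j <= k)%N -> W x -> X x -> ~ (C `\` A0) (iter k f x).
  by apply: escape; [exact: sub_closed|move=> x []/CX|case].
exists (W `&` [set x | X x -> A0 (iter n f x)]).
  apply: filterI; first exact: Wnbhs.
  by apply: nbhs_f; exact: open_nbhs_nbhs.
have Ein j x : (n <= j)%N -> W x -> X x -> A0 (iter n f x) -> A0 (iter j f x).
  move=> /subnK <-; elim: (j - n)%N => [|k ih]// Wx Xx A0x.
  have := nA0 (k + n).+1 x (leqW (leq_addl _ _)) Wx Xx => /not_andP[|/contrapT//].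
  case; apply: G0C; split; last exact: iX.
  by apply: (A0G _ (ih Wx Xx A0x)).2; exact: iX.
move=> G; rewrite nbhsE => -[D [Do Dp] DG].
have [m _ /(_ m (leqnn m)) mD] : \forall j \near \oo,
    forall k x, (j <= k)%N -> W x -> X x -> ~ (C `\` D) (iter k f x).
  by apply: escape; [exact: sub_closed|move=> x []/CX|case].
near=> j => x [Wx /[swap] Xx /(_ Xx) A0x]; apply: DG.
have nj : (n <= j)%N by near: j; exact: nbhs_infty_ge.
have mj : (m <= j)%N by near: j; exact: nbhs_infty_ge.
have := mD j x mj Wx Xx => /not_andP[|/contrapT//].
case; apply: G0C; split; last exact: iX.
by apply: (A0G _ _).1; exact: Ein.
Unshelve. all: by end_near. Qed.

Lemma image_iter f K j : f @` K = K -> iter j f @` K = K.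
Proof.
move=> fK; elim: j => [|j ih]; first by rewrite (_ : iter 0 f = id)// image_id.
by rewrite -[in RHS]fK -[in RHS]ih image_comp.
Qed.

Lemma uniform_attractor f K W : hausdorff_space T ->
  f @` K = K -> compact K -> set_nbhs K W ->
  (forall x, ~ K x -> exists2 U, nbhs x U &
     \forall j \near \oo, forall k y, (j <= k)%N -> W y -> ~ U (iter k f y)) ->
  attractor [set: T] f K.
Proof.
move=> hT fK Kc KW unif; split => //; exists W => //.
apply/seteqP; split => x.
  move=> Kx n /= n0; split=> //; apply: subset_closure.
  exists n => /=; first exact: leqnn.
  move: Kx; rewrite -{1}(image_iter n fK) => -[y Ky <-].
  by exists y => //; split => //; exact: nbhs_singleton (KW _ Ky).
move=> xom; apply: contrapT => /unif[U Ux [n _ /(_ n.+1 (leqW (leqnn n))) nU]].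
have [_ /(_ _ Ux)[_ [[k /= nk [y [Wy _] <-]] Uy]]] := xom n.+1 isT.
exact: nU nk Wy Uy.
Qed.

End Attraction.

(** * Charts *)

(** Stated in an abstract normed module, where the continuity of addition is
    found without unfolding the topology of matrices. *)
Lemma translation_is_map (R : numFieldType) (W : normedModType R) (c : W) :
  is_map [set: W] [set: W] (fun y => y + c).
Proof.
apply: continuous_is_map => // y _.
by apply: cvgD; [exact: cvg_id|exact: cvg_cst].
Qed.

Section Charts.
Context {R : realType} {n : nat} {M : metricType R}.
Notation V := 'rV[R]_n.

Definition open_disc (r : R) : set V := [set y | `|y| < r].

Lemma open_open_disc r : open (open_disc r).
Proof.
apply: (@open_comp V R (fun x => `|x|) [set t | t < r]); last exact: open_lt.
by move=> x _; exact: norm_continuous.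
Qed.

(** [D] is the open set of the ambient space on which the chart [phi], with
    inverse [psi], is defined. *)
Definition centered_chart (N D : set M) (phi : M -> V) (psi : V -> M) (p : M) :=
  [/\ open D, D p, inverse_homeos (N `&` D) [set: V] phi psi & psi 0 = p].

Lemma manifold_chart (N : set M) p : manifold n N -> N p ->
  exists D phi psi, centered_chart N D phi psi p.
Proof.
move=> Nm Np; have [D [Do Dp [phi [psi [phim psim psiK phiK]]]]] := Nm p Np.
exists D, (fun x => phi x - phi p), (fun y => psi (y + phi p)); split => //.
- split.
  + have tm : is_map [set: V] [set: V] (fun y => y - phi p).
      exact: translation_is_map.
    exact: is_map_comp phim tm.
  + have tm : is_map [set: V] [set: V] (fun y => y + phi p).
      exact: translation_is_map.
    exact: is_map_comp tm psim.
  + by move=> x Nx /=; rewrite subrK psiK.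
  + by move=> y _ /=; rewrite phiK// addrK.
- by rewrite add0r psiK.
Qed.

Section Chart.
Context {N D : set M} {phi : M -> V} {psi : V -> M} {p : M}
  (chart : centered_chart N D phi psi p).

(** Chart-open sets are traces on [N] of open sets of [M]; this is how conditions
    in the chart are made into open conditions off [N]. *)
Lemma chart_open (U : set V) : open U -> exists2 W, open W & W `&` N = psi @` U.
Proof.
move=> Uo; have [Do Dp [[/within_continuousE phic _] [_ psiN] psiK phiK] _] := chart.
exists ([set x | N x -> D x /\ U (phi x)]°); first exact: open_interior.
apply/seteqP; split => [x [/nbhs_singleton/= Wx Nx]|_ [y Uy <-]].
  have [Dx Ux] := Wx Nx; exists (phi x) => //; exact: psiK.
have [Ny Dy] := psiN y I; split => //.
have Uphi : nbhs (phi (psi y)) U by rewrite phiK//; exact: open_nbhs_nbhs.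
apply: filterS2 (open_nbhs_nbhs (conj Do Dy)) (phic _ (conj Ny Dy) _ Uphi) => x Dx Ux Nx.
by split=> //; exact: Ux.
Qed.

Lemma chart_small U : nbhs p U -> exists2 r, 0 < r & psi @` disc r `<=` U.
Proof.
have [_ _ [_ [/within_continuousE psic _] _ _] psi0] := chart.
rewrite -psi0 => /(psic 0 I) /nbhs_ballP[r /= r0 rU].
exists (r / 2); first exact: divr_gt0.
move=> _ [y yr <-]; apply: rU => //; rewrite -ball_normE/= sub0r normrN.
by rewrite (le_lt_trans yr)// ltr_pdivrMr// ltr_pMr// ltr1n.
Qed.

Lemma chart_disc_compact r : compact (psi @` disc r).
Proof.
have [_ _ [_ [psic _] _ _] _] := chart.
by apply: continuous_compact (@compact_disc R n r); exact: continuous_subspaceW psic.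
Qed.

Lemma chart_sub U : psi @` U `<=` N.
Proof. by have [_ _ [_ [_ psiN] _ _] _] := chart; move=> _ [y _ <-]; have [] := psiN y I. Qed.

Lemma chart_disc_nbhs r : 0 < r -> exists W, [/\ open W, W p & W `&` N = psi @` open_disc r].
Proof.
move=> r0; have [W Wo WN] := chart_open (@open_open_disc r).
exists W; split => //; suff [] : (W `&` N) p by [].
rewrite WN; have [_ _ _ <-] := chart.
by exists 0 => //; rewrite /open_disc/= normr0.
Qed.

Lemma chart_attraction f : is_map N N f -> attractor N f [set p] ->
  exists2 E, nbhs p E & forall G, nbhs p G ->
    \forall j \near \oo, forall x, E x -> N x -> G (iter j f x).
Proof.
move=> fm fatt; have [W [Wo Wp WN]] := chart_disc_nbhs ltr01.
apply: (attraction_to_point _ fm fatt (@chart_disc_compact 1) _ (open_nbhs_nbhs (conj Wo Wp))).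
- exact: metric_hausdorff.
- exact: chart_sub.
- by rewrite WN; apply: image_subset => y /ltW.
Qed.

End Chart.
End Charts.

(** * The attractor inside a trapping region *)

Lemma near_forall_lt (T : Type) (F : set_system T) (m : nat) (P : nat -> set T) :
  Filter F -> (forall j, (j < m)%N -> \forall x \near F, P j x) ->
  \forall x \near F, forall j, (j < m)%N -> P j x.
Proof.
move=> FF; elim: m => [|m ih] FP; first exact: nearW.
apply: filterS2 (ih (fun j jm => FP j (leqW jm))) (FP m (leqnn _)) => x xP xm j.
by rewrite ltnS leq_eqVlt => /orP[/eqP->|/xP].
Qed.

Definition trapped_core (T : Type) (f' : T -> T) (B : set T) : set T :=
  [set x | forall j, B (iter j f' x)].

(** If [W] is a neighborhood of a repeller in the core, this removes from the
    core the unstable set of the repeller. *)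
Definition dual_attractor (T : Type) (f' : T -> T) (B W : set T) : set T :=
  [set x | trapped_core f' B x /\ forall j, ~ W (iter j f' x)].

Section TrappedSphere.
Context {R : realType} {n : nat} {M : metricType R}.
Notation V := 'rV[R]_n.
Context {N D : set M} {phi : M -> V} {psi : V -> M} {p : M}
  (chart : centered_chart N D phi psi p)
  {f f' : M -> M} (ff' : inverse_homeos [set: M] [set: M] f f')
  (fN : f @` N = N)
  {B G : set M} {r : R} {k : nat}
  (Bc : compact B) (Go : open G) (GB : G `<=` B)
  (GN : G `&` N `<=` psi @` open_disc r) (rB : psi @` disc r `<=` B) (r0 : 0 < r)
  (trap : forall j x, (k <= j)%N -> B x -> G (iter j f x)).

Let fK x : f' (f x) = x. Proof. by have [_ _ + _] := ff'; exact. Qed.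
Let f'K x : f (f' x) = x. Proof. by have [_ _ _ +] := ff'; exact. Qed.

Lemma iterfK j x : iter j f' (iter j f x) = x.
Proof. by elim: j x => // j ih x; rewrite iterSr/= fK ih. Qed.

Lemma iterf'K j x : iter j f (iter j f' x) = x.
Proof. by elim: j x => // j ih x; rewrite iterSr/= f'K ih. Qed.

Lemma iterf'_sub i j x : (i <= j)%N -> iter i f' (iter j f x) = iter (j - i) f x.
Proof. by move=> ij; rewrite -{1}(subnKC ij) iterD iterfK. Qed.

Lemma near_iter j x U : nbhs (iter j f x) U -> \forall y \near x, U (iter j f y).
Proof.
have [fm _ _ _] := ff'; have [/within_continuousE c _] := is_map_iter j fm.
by move=> /(c x I); apply: filterS => y; exact.
Qed.

Lemma near_iter' j x U : nbhs (iter j f' x) U -> \forall y \near x, U (iter j f' y).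
Proof.
have [_ fm _ _] := ff'; have [/within_continuousE c _] := is_map_iter j fm.
by move=> /(c x I); apply: filterS => y; exact.
Qed.

Lemma N_iter j x : N x -> N (iter j f x).
Proof. by elim: j => // j ih Nx; rewrite /= -fN; exists (iter j f x) => //; exact: ih. Qed.

Lemma N_iter' j x : N x -> N (iter j f' x).
Proof.
elim: j => // j ih /ih; rewrite -{1}fN => -[y Ny /= <-]; by rewrite fK.
Qed.

Let Bcl : closed B. Proof. exact: compact_closed (@metric_hausdorff R M) Bc. Qed.

Notation A := (trapped_core f' B).

(** A point with backward orbit in [B] is the [k]-th image of a point of [B], so
    its image is a later image of that point and is still in [B]. *)
Lemma core_image x : A x -> A (f x).
Proof.
move=> Ax [|j]; last by rewrite iterSr fK; exact: Ax.
apply: GB; rewrite /= -(iterf'K k x); exact: (@trap k.+1) (leqnSn k) (Ax k).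
Qed.

Lemma core_preimage j x : A x -> A (iter j f' x).
Proof. by move=> Ax i; rewrite -iterD; exact: Ax. Qed.

Lemma core_sub : A `<=` G.
Proof. by move=> x Ax; rewrite -(iterf'K k x); apply: trap => //; exact: Ax. Qed.

Lemma core_compact : compact A.
Proof.
apply: (subclosed_compact _ Bc) => [|x /(_ 0%N)//].
have -> : A = \bigcap_j (iter j f' @^-1` B).
  by apply/seteqP; split => [x Ax j _|x Ax j]; [exact: Ax|exact: (Ax j I)].
apply: closed_bigI => j _.
by apply: preimage_closed => // x _ U /near_iter'.
Qed.

(** A point of [B] outside the neighborhood leaves [B] within a bounded backward
    time [m], by compactness; an image of [B] under at least [m + k] iterates
    does not. *)
Lemma core_attraction U : A `<=` U° ->
  \forall j \near \oo, forall x, B x -> U (iter j f x).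
Proof.
move=> AU.
have : \forall m \near \oo, (B `\` U°) `<=`
    (fun y => exists2 l, (l <= m)%N & ~ B (iter l f' y)).
  apply: (compact_near_coveringP _).1.
    by apply: compact_closedI => //; apply: open_closedC; exact: open_interior.
  move=> y [By /(contra_not (AU y))/existsNP[l nBl]].
  have nBy : nbhs y [set z | ~ B (iter l f' z)].
    apply: (@near_iter' l y (~` B)); apply: open_nbhs_nbhs.
    by split => //; exact: closed_openC.
  exists ([set z | ~ B (iter l f' z)], [set m | (l <= m)%N]).
    by split => //; exact: nbhs_infty_ge.
  by move=> [z m] [/= nBz lm]; exists l.
move=> [m _ /(_ m (leqnn m)) mP]; exists (m + k)%N => // j /= mkj x Bx.
apply: nbhs_singleton; apply: contrapT => nU.
have kj : (k <= j)%N by exact: leq_trans (leq_addl _ _) mkj.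
have [l lm] := mP _ (conj (GB (trap kj Bx)) nU).
have lj : (l <= j)%N by rewrite (leq_trans lm)// (leq_trans _ mkj)// leq_addr.
rewrite iterf'_sub//; apply; apply: GB; apply: trap => //.
by rewrite leq_subRL// (leq_trans _ mkj)// leq_add2r.
Qed.

Context (AN : A `<=` N).

Context {s : R} {W : set M} {m : nat}
  (s0 : 0 < s) (sr : s <= r) (Wo : open W)
  (WN : W `&` N = psi @` open_disc s)
  (repel : forall j x, (m <= j)%N -> (psi @` disc s) x -> W (iter j f' x)).

Let W_disc x : W x -> N x -> (psi @` disc s) x.
Proof.
move=> Wx Nx; have : (W `&` N) x by [].
by rewrite WN; apply: image_subset => y /ltW.
Qed.

Notation K := (dual_attractor f' B W).

Lemma dual_preimage j x : K x -> K (iter j f' x).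
Proof.
by move=> [Ax Wx]; split; [exact: core_preimage|move=> i; rewrite -iterD; exact: Wx].
Qed.

Lemma dual_disc x : K x -> ~ (psi @` disc s) x.
Proof. by move=> [_ Wx] xs; apply: (Wx m); exact: repel. Qed.

Lemma dual_invariant : f @` K = K.
Proof.
apply/seteqP; split => [_ [x [Ax Wx] <-]|x Kx]; last first.
  by exists (f' x); [exact: (@dual_preimage 1%N)|exact: f'K].
split; first exact: core_image.
move=> [|j]; last by rewrite iterSr fK; exact: Wx.
move=> /= Wfx; apply: (Wx m); rewrite -{1}(fK x) -iterSr.
by apply: repel => //; apply: W_disc Wfx _; apply: AN; exact: core_image.
Qed.

Lemma dual_compact : compact K.
Proof.
have -> : K = A `&` \bigcap_j (iter j f' @^-1` (~` W)).
  apply/seteqP; split => [x [Ax Wx]|x [Ax Wx]]; split => // j; first by move=> _; exact: Wx.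
  exact: (Wx j I).
apply: compact_closedI; first exact: core_compact.
apply: closed_bigI => j _.
by apply: preimage_closed (open_closedC Wo) => // x _ U /near_iter'.
Qed.

(** The same argument, with entering [W] in place of leaving [B]: points of the
    core off [U] enter [W] within a bounded backward time, and so do all points
    close to the core and off [U].  A late image of a point of [N] outside [W]
    is close to the core; if it were off [U], some intermediate iterate would be
    in the disc [W `&` N], which long backward iteration maps into [W], so the
    point itself would be in [W]. *)
Lemma dual_attraction U : open U -> K `<=` U ->
  \forall j \near \oo, forall x, B x -> N x -> ~ W x -> U (iter j f x).
Proof.
move=> Uo KU.
have Wnear l x : W (iter l f' x) -> nbhs x [set z | W (iter l f' z)].
  by move=> Wl; apply: (@near_iter' l x W); exact: open_nbhs_nbhs.
have : \forall i \near \oo, (A `\` U) `<=`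
    (fun y => exists2 l, (l <= i)%N & W (iter l f' y)).
  apply: (compact_near_coveringP _).1.
    by apply: compact_closedI; [exact: core_compact|exact: open_closedC].
  move=> y [Ay /(contra_not (KU y))] /not_andP[//|/existsNP[l /contrapT Wl]].
  exists ([set z | W (iter l f' z)], [set i | (l <= i)%N]).
    by split => /=; [exact: Wnear|exact: nbhs_infty_ge].
  by move=> [z i] [/= Wz li]; exists l.
move=> [i _ /(_ i (leqnn i)) iP].
have /core_attraction Aatt : A `<=`
    [set y | U y \/ exists2 l, (l <= i)%N & W (iter l f' y)]°.
  move=> y Ay; have [Uy|nUy] := pselect (U y).
    by apply: filterS (open_nbhs_nbhs (conj Uo Uy)) => z; left.
  have [l li Wl] := iP _ (conj Ay nUy).
  by apply: filterS (Wnear _ _ Wl) => z Wz; right; exists l.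
near=> j => x Bx Nx nWx.
have [//|] : (fun y => U y \/ exists2 l, (l <= i)%N & W (iter l f' y)) (iter j f x).
  by move: x Bx {Nx nWx}; near: j.
have ij : (i + m <= j)%N by near: j; exact: nbhs_infty_ge.
move=> [l li]; have lj : (l <= j)%N.
  by rewrite (leq_trans li)// (leq_trans _ ij)// leq_addr.
rewrite iterf'_sub// => /W_disc/(_ (N_iter _ Nx)) ws; exfalso; apply: nWx.
rewrite -(iterfK (j - l) x); apply: repel => //.
by rewrite leq_subRL// (leq_trans _ ij)// leq_add2r.
Unshelve. all: by end_near. Qed.

(** Points of [M] close to [K] are not controlled by [dual_attraction], as they
    need not lie in [N].  Let [T] be a closed neighborhood of [K] disjoint from the disc.  The part of
    [T] in the core moves into the interior [Z] of [T] at all times from [j1] to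
    [2 j1], and therefore so do the points of [T] close enough to the core, that
    is, those in a high image of [B].  These points stay in the high image, so
    by induction on time they stay in [T] at all times from [j1] on.  The same
    comparison with the core shows that they enter every neighborhood of [K]. *)
Lemma dual_is_attractor : attractor [set: M] f K.
Proof.
have Dcl : closed (psi @` disc s).
  exact: compact_closed (@metric_hausdorff R M) (chart_disc_compact chart (r := s)).
have [Z [Zo KZ Zs]] := compact_closed_separation dual_compact Dcl dual_disc.
pose T := closure Z; have ZT : Z `<=` T by exact: subset_closure.
have TW x : A x -> T x -> ~ W x.
  by move=> Ax Tx Wx; apply: (Zs x Tx); apply: W_disc Wx _; exact: AN.
have AB x : A x -> B x by move=> /(_ 0%N).
have nTnear x : ~ T x -> nbhs x (~` T).
  by move=> nT; apply: open_nbhs_nbhs; split => //; apply: closed_openC; exact: closed_closure.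
have Ynear Z' l : open Z' -> (forall x, B x -> N x -> ~ W x -> Z' (iter l f x)) ->
    forall x, A x -> nbhs x [set y | T y -> Z' (iter l f y)].
  move=> Z'o Z'P x Ax; have [Tx|/nTnear] := pselect (T x); last first.
    by apply: filterS => y nT /nT.
  have Z'x : nbhs (iter l f x) Z'.
    apply: open_nbhs_nbhs; split => //; apply: Z'P; [exact: AB|exact: AN|exact: TW].
  by apply: filterS (near_iter Z'x) => y Z'y _.
have [j0 _ j0P] := dual_attraction Zo KZ.
pose j1 := j0.+1.
have j1P j : (j1 <= j)%N -> forall x, B x -> N x -> ~ W x -> Z (iter j f x).
  by move=> jj; apply: j0P; exact: ltnW jj.
pose Y y := forall j, (j < j1 + j1.+1)%N -> (j1 <= j)%N -> T y -> Z (iter j f y).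
have /core_attraction[i _ iP] : A `<=` [set y | Y y]°.
  move=> x Ax; apply: near_forall_lt => j _.
  have [jj|nj] := boolP (j1 <= j)%N; last by apply: nearW.
  by apply: filterS (Ynear Z j Zo (j1P j jj) x Ax) => y Yy _.
(* the attracted neighborhood: the points of [T] in the [i]-th image of [B] *)
pose W0 := [set y | T y /\ B (iter i f' y)].
have W0iter y l : W0 y -> iter l f y = iter (l + i) f (iter i f' y).
  by move=> _; rewrite iterD iterf'K.
have stay j y : W0 y -> (j1 <= j)%N -> Z (iter j f y).
  move=> W0y; have [Ty By] := W0y; elim/ltn_ind: j => j ih jj.
  have Yl l : Y (iter l f y) by rewrite W0iter//; apply: iP => //=; exact: leq_addl.
  have [jle|jlt] := ltnP j (j1 + j1.+1).
    exact: (Yl 0%N).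
  have j1j : (j1 <= j - j1)%N.
    by rewrite leq_subRL// (leq_trans _ jlt)// leq_add2l.
  rewrite -(subnKC jj) iterD; apply: Yl => //; first by rewrite addnS ltnS leq_addr.
  by apply: ZT; apply: ih => //; rewrite ltn_subrL/= (leq_trans _ jj).
apply: (@uniform_attractor _ f K W0).
- exact: metric_hausdorff.
- exact: dual_invariant.
- exact: dual_compact.
- move=> x Kx; apply: filterI.
    by apply: filterS ZT (open_nbhs_nbhs (conj Zo (KZ _ Kx))).
  apply: near_iter'; apply: filterS GB _; apply: open_nbhs_nbhs; split => //.
  by apply: core_sub; have [] := dual_preimage i Kx.
move=> x nKx.
have xcl : closed [set x].
  by apply: compact_closed; [exact: metric_hausdorff|exact: compact_set1].
have Kx : K `<=` ~` [set x] by move=> y Ky /= yx; apply: nKx; rewrite -yx.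
have [Z' [Z'o KZ' Z'x]] := compact_closed_separation dual_compact xcl Kx.
exists (~` closure Z').
  apply: open_nbhs_nbhs; split; first by apply: closed_openC; exact: closed_closure.
  by move=> /Z'x; apply.
have [l _ /(_ l (leqnn l)) lP] := dual_attraction Z'o KZ'.
have /core_attraction[i' _ i'P] : A `<=` [set y | T y -> Z' (iter l f y)]°.
  by move=> y Ay; exact: Ynear.
exists (l + (j1 + i'))%N => // j0' /= lj q y jq W0y; apply; apply: subset_closure.
have lq : (l + (j1 + i') <= q)%N by exact: leq_trans lj jq.
have lq' : (l <= q)%N by rewrite (leq_trans _ lq)// leq_addr.
have jl : (j1 + i' <= q - l)%N by rewrite leq_subRL.
rewrite -(subnKC lq') iterD.
have Tl : T (iter (q - l) f y).
  by apply: ZT; apply: stay => //; rewrite (leq_trans _ jl)// leq_addr.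
move: Tl; rewrite W0iter//; apply: i'P; last exact: W0y.2.
by rewrite /= (leq_trans (leq_addl j1 i'))// (leq_trans jl)// leq_addr.
Qed.

(** In the chart, the [j]-th iterate embeds the disc of radius [r] fixing the
    origin, and for [j] large it carries the annulus between the radii [s] and
    [r] into a given neighborhood of [K] by [dual_attraction].  That the image is
    itself a neighborhood of [K], and that of the disc one of the origin, follows
    from the continuity of the inverse iterate, which maps [N] to [N]. *)
Lemma dual_shape : f p = p -> same_shape R K (@sphere R n).
Proof.
move=> fp; have [Do Dp phi_psi psi0] := chart.
have [phim psim psiK phiK] := phi_psi.
have psiN y : N (psi y) /\ D (psi y) by exact: psim.2.
have KD x : K x -> (psi @` open_disc r) x.
  by move=> [Ax _]; apply: GN; split; [exact: core_sub|exact: AN].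
have KND : K `<=` N `&` D by move=> x /KD[y _ <-].
have phiPsi x : N x -> D x -> psi (phi x) = x by move=> Nx Dx; exact: psiK.
have psiPhi y : phi (psi y) = y by exact: phiK.
have hK : homeomorphic K (phi @` K).
  exists phi, psi; apply: inverse_homeos_sub phi_psi => //.
  by move=> _ [x Kx <-]; have [Nx Dx] := KND _ Kx; rewrite phiPsi.
apply: (nested_annuli_shape hK).
  apply: continuous_compact dual_compact.
  exact: continuous_subspaceW KND phim.1.
move=> U Uo KU; have [WU WUo WUN] := chart_open chart Uo.
have KWU : K `<=` WU.
  move=> x Kx; have [Nx Dx] := KND _ Kx.
  suff [] : (WU `&` N) x by [].
  by rewrite WUN; exists (phi x); [apply: KU; exists x|exact: phiPsi].
have [j0 _ j0P] := dual_attraction WUo KWU.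
pose j := (j0 + k)%N.
have jP x : B x -> N x -> ~ W x -> WU (iter j f x) by apply: j0P; exact: leq_addr.
pose F := iter j f \o psi; pose F' := iter j f' \o psi.
have [fm f'm _ _] := ff'.
have FD y : disc r y -> (N `&` D) (F y).
  move=> yr; have NF : N (F y) by apply: N_iter; have [] := psiN y.
  have [|z zr <-] := GN (_ : (G `&` N) (F y)); last exact: psiN.
  by split => //; apply: trap; [exact: leq_addl|apply: rB; exists y].
pose e := phi \o F; pose e' := phi \o F'.
have psie y : disc r y -> psi (e y) = F y.
  by move=> /FD[NF DF]; exact: phiPsi.
have e'e y : disc r y -> e' (e y) = y.
  by move=> yr; rewrite /e' /F' /= psie// iterfK psiPhi.
have psiT : is_map [set: V] [set: M] psi by apply: is_map_sub psim.
have Fm : is_map (disc r) (N `&` D) F.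
  split; last exact: FD.
  apply: (is_map_comp _ (is_map_iter j fm)).1.
  exact: is_map_sub psiT.
have em : is_map (disc r) (e @` disc r) e.
  split; last by move=> y yr; exists y.
  exact: (is_map_comp Fm phim).1.
have e'm : is_map (e @` disc r) (disc r) e'.
  split; last by move=> _ [y yr <-]; rewrite e'e.
  have F'm : is_map (e @` disc r) (N `&` D) F'.
    split; last by move=> _ [y yr <-]; rewrite /F' /= psie// iterfK; exact: psiN.
    apply: (is_map_comp _ (is_map_iter j f'm)).1.
    exact: is_map_sub psiT.
  exact: (is_map_comp F'm phim).1.
have image_nbhs (Om : set V) x : open Om -> (psi @` Om) (iter j f' (psi x)) ->
    nbhs x (e @` Om).
  move=> Omo xOm; have [WO WOo WON] := chart_open chart Omo.
  have WOx : WO (iter j f' (psi x)).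
    by suff [] : (WO `&` N) (iter j f' (psi x)) by []; rewrite WON.
  have [/within_continuousE psic _] := psiT.
  have := psic x I _ (near_iter' (open_nbhs_nbhs (conj WOo WOx))).
  apply: filterS => x' /(_ I) WOx'.
  have : (WO `&` N) (iter j f' (psi x')).
    by split => //; apply: N_iter'; have [] := psiN x'.
  rewrite WON => -[y Oy yx']; exists y => //.
  by rewrite /e /F /= yx' iterf'K psiPhi.
exists s, r, e, e'; split.
- by rewrite s0 sr.
- split => //; first by move=> _ [y yr <-]; rewrite e'e.
- split; first by rewrite /e /F /= psi0 iter_fix// -psi0 psiPhi.
  apply: filterS (image_nbhs (open_disc r) 0 _ _).
  + by apply: image_subset => y /ltW.
  + exact: open_open_disc.
  + exists 0; first by rewrite /open_disc/= normr0.
    by rewrite psi0 -{2}(iter_fix j fp) iterfK.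
- move=> _ [x Kx <-]; have [Nx Dx] := KND _ Kx.
  have Kjx := dual_preimage j Kx; have [y yr yx] := KD _ Kjx.
  have sy : s < `|y|.
    rewrite ltNge; apply/negP => ys; apply: (dual_disc Kjx).
    by exists y.
  apply: filterS (image_nbhs ([set y : V | s < `|y|] `&` open_disc r) _ _ _).
  + by apply: image_subset => z [/= /ltW sz /ltW zr]; rewrite /annulus/= sz zr.
  + apply: openI (@open_open_disc _ _ r).
    apply: (@open_comp V R (fun x => `|x|) [set t | s < t]); last exact: open_gt.
    by move=> z _; exact: norm_continuous.
  + by exists y => //; rewrite yx phiPsi.
- move=> _ [y /andP[sy yr] <-].
  have Ny : N (psi y) by have [] := psiN y.
  have nW : ~ W (psi y).
    move=> Wy; have : (W `&` N) (psi y) by [].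
    rewrite WN => -[z zs /(congr1 phi)]; rewrite !psiPhi => zy.
    by move: zs; rewrite zy /open_disc/= ltNge sy.
  have : (WU `&` N) (F y).
    by split; [apply: jP => //; apply: rB; exists y|exact: N_iter].
  by rewrite WUN => -[z Uz zF]; rewrite /e /= -zF psiPhi.
Qed.

End TrappedSphere.

(** * Persistence and conclusion *)

(** The repelling disc is obtained by applying [attraction_to_point] to the
    inverse of [f] on [N]. *)
Lemma sphere_attractor (R : realType) (n : nat) (M : metricType R)
    (N D B G V : set M) (phi : M -> 'rV[R]_n) (psi : 'rV[R]_n -> M) (p : M)
    (f : M -> M) (r : R) (k : nat) :
  centered_chart N D phi psi p -> is_homeo [set: M] [set: M] f ->
  f @` N = N -> N p -> repeller N f [set p] ->
  B `<=` V -> maximal_invariant f V `<=` N ->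
  compact B -> open G -> G `<=` B -> G `&` N `<=` psi @` open_disc r ->
  psi @` disc r `<=` B -> 0 < r ->
  (forall j x, (k <= j)%N -> B x -> G (iter j f x)) ->
  exists K : set M, [/\ K `<=` B, f @` K = K, attractor [set: M] f K &
    same_shape R K (@sphere R n)].
Proof.
move=> chart [f' ff'] fN Np [g gg gatt] BV VN Bc Go GB GN rB r0 trap.
have [_ _ fK f'K] := ff'.
have [fm gm gfK fgK] := gg.
have gp : g p = p := attractor_fixpoint gm gatt.
have fp : f p = p by rewrite -{1}gp fgK.
have gf' x : N x -> g x = f' x by move=> Nx; rewrite -{2}(fgK x Nx) fK.
have iter_gf' j x : N x -> iter j g x = iter j f' x.
  move=> Nx; elim: j => //= j <-; apply: gf'.
  exact: (is_map_iter j gm).2.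
have AN : trapped_core f' B `<=` N.
  move=> x Ax; apply: VN; exists (trapped_core f' B) => //; split.
    by move=> y /(_ 0%N)/BV.
  apply/seteqP; split => [_ [y Ay <-]|y Ay]; first exact: (core_image ff' GB trap).
  exists (f' y); last by rewrite f'K.
  exact: (@core_preimage _ _ _ _ 1%N).
have [E Ep Eatt] := chart_attraction chart gm gatt.
have [s1 s10 s1E] := chart_small chart Ep.
pose s := Num.min s1 r.
have s0 : 0 < s by rewrite lt_min s10.
have sr : s <= r by rewrite ge_min lexx orbT.
have sE : psi @` disc s `<=` E.
  apply: subset_trans s1E; apply: image_subset => y ys.
  by rewrite /disc/= (le_trans ys)// ge_min lexx.
have [W [Wo Wp WN]] := chart_disc_nbhs chart s0.
have [m _ mW] := Eatt _ (open_nbhs_nbhs (conj Wo Wp)).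
have repel j x : (m <= j)%N -> (psi @` disc s) x -> W (iter j f' x).
  move=> mj xs; have Nx := chart_sub chart xs.
  by rewrite -iter_gf'//; apply: mW => //; exact: sE.
exists (dual_attractor f' B W); split.
- by move=> x [/(_ 0%N)].
- exact: (dual_invariant ff' GB trap AN WN repel).
- exact: (dual_is_attractor chart ff' fN Bc Go GB trap AN Wo WN repel).
- exact: (dual_shape chart ff' fN Bc GB GN rB r0 trap AN s0 sr Wo WN repel fp).
Qed.

Lemma iterate_persistence (R : realType) (M : topologicalType) (f : R -> M -> M)
    (B G : set M) j :
  {within [set: M] `*` `[0, 1], continuous (fun z : M * R => f z.2 z.1)} ->
  compact B -> open G -> (forall x, B x -> G (iter j (f 0) x)) ->
  \forall l \near within `[0, 1] (nbhs (0 : R)), forall x, B x -> G (iter j (f l) x).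
Proof.
move=> fc Bc Go BG.
have fm : @is_map (M * R)%type M ([set: M] `*` `[0, 1]) [set: M]
  (fun z => f z.2 z.1) by [].
have im : @is_map (M * R)%type M ([set: M] `*` `[0, 1]) [set: M]
    (fun z => iter j (f z.2) z.1).
  elim: j {BG} => [|j ih]; first exact: is_map_fst.
  exact: is_map_comp (is_map_pair ih (is_map_snd _ _)) fm.
apply: (compact_near_coveringP B).1 => // x Bx.
have z01 : ([set: M] `*` `[0, 1 : R]) (x, 0).
  by split => //=; rewrite in_itv/= lexx ler01.
have [/within_continuousE ic _] := im.
have [[U1 U2] [/= U1x U20] UG] := ic _ z01 _ (open_nbhs_nbhs (conj Go (BG x Bx))).
exists (U1, [set l | l \in `[0, 1] /\ U2 l]) => /=.
  by split => //; apply: filterS U20 => l U2l l01; split.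
by move=> [x' l] [/= U1x' [l01 U2l]]; apply: (UG (x', l)).
Qed.

Theorem theorem18 (R : realType) (d n : nat) (M : metricType R)
    (f : R -> M -> M) (N : set M) (p : M) :
  manifold d [set: M] ->
  (forall l, 0 <= l <= 1 -> is_homeo [set: M] [set: M] (f l)) ->
  {within [set: M] `*` `[0, 1], continuous (fun z : M * R => f z.2 z.1)} ->
  manifold n N ->
  (forall l, 0 <= l <= 1 -> f l @` N = N) ->
  N p ->
  attractor [set: M] (f 0) [set p] ->
  (forall l, 0 < l <= 1 -> repeller N (f l) [set p]) ->
  (exists2 V : set M, nbhs p V &
     forall l, 0 <= l <= 1 -> maximal_invariant (f l) V `<=` N) ->
  exists (l0 : R) (K : R -> set M),
    [/\ 0 < l0 <= 1,
        (forall l, 0 < l < l0 ->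
           attractor [set: M] (f l) (K l) /\
           same_shape R (K l) (@sphere R n)) &
        upper_semicontinuous_to l0 K [set p]].
Proof.
move=> Mm fh fc Nm fN Np att rep [V Vp VN].
have [D0 [phi0 [psi0 chart0]]] := manifold_chart Mm (I : [set: M] p).
have [D [phi [psi chart]]] := manifold_chart Nm Np.
have f0m : is_map [set: M] [set: M] (f 0).
  by have [|g []] := fh 0; first by rewrite lexx ler01.
have [E Ep Eatt] := chart_attraction chart0 f0m att.
have [b b0 bEV] := chart_small chart0 (filterI Ep Vp).
pose B := psi0 @` disc b.
have Bc : compact B := chart_disc_compact chart0 (r := b).
have Bp : nbhs p B.
  have [W [Wo Wp WB]] := chart_disc_nbhs chart0 b0.
  apply: filterS (open_nbhs_nbhs (conj Wo Wp)) => x Wx.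
  have : (W `&` [set: M]) x by [].
  by rewrite WB; apply: image_subset => y /ltW.
have BE x : B x -> E x by move=> /bEV[].
have BV : B `<=` V by move=> x /bEV[].
have [r r0 rB] := chart_small chart Bp.
have [W [Wo Wp WN]] := chart_disc_nbhs chart r0.
pose G := W `&` B°.
have Go : open G by apply: openI => //; exact: open_interior.
have Gp : nbhs p G by apply: open_nbhs_nbhs.
have GB : G `<=` B by move=> x [_ /nbhs_singleton].
have GN : G `&` N `<=` psi @` open_disc r by rewrite -WN => x [[]].
have [k0 _ k0P] := Eatt G Gp.
pose k := k0.+1.
(* controlling the iterates from [k] to [2 k] controls all later ones, as the
   [k]-th image of [B] lies in [B] *)
have : \forall l \near within `[0, 1] (nbhs (0 : R)), forall j, (j < k + k.+1)%N ->
    (k <= j)%N -> forall x, B x -> G (iter j (f l) x).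
  apply: near_forall_lt => j _; have [kj|nkj] := boolP (k <= j)%N; last by apply: nearW.
  have k0j x : B x -> G (iter j (f 0) x).
    by move=> Bx; apply: k0P => //; [exact: ltnW|exact: BE].
  by apply: filterS (iterate_persistence fc Bc Go k0j) => l lG _.
move=> /nbhs_ballP[e /= e0 eP].
pose l0 := Num.min e 1.
have l00 : 0 < l0 by rewrite lt_min e0 ltr01.
have l01 : l0 <= 1 by rewrite ge_min lexx orbT.
have trap l : 0 < l < l0 -> forall j x, (k <= j)%N -> B x -> G (iter j (f l) x).
  move=> /andP[lgt0 ll0] j x.
  have lP i : (i < k + k.+1)%N -> (k <= i)%N -> forall x, B x -> G (iter i (f l) x).
    apply: eP.
      rewrite -ball_normE/= sub0r normrN gtr0_norm// (lt_le_trans ll0)//.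
      by rewrite ge_min lexx.
    by rewrite /= in_itv/= (ltW lgt0) (ltW (lt_le_trans ll0 l01)).
  elim/ltn_ind: j x => j ih x kj Bx.
  have [jlt|jge] := ltnP j (k + k.+1); first exact: lP.
  have kjk : (k <= j - k)%N by rewrite leq_subRL// (leq_trans _ jge)// leq_add2l.
  rewrite -(subnKC kj) iterD; apply: lP => //; first by rewrite addnS ltnS leq_addr.
  by apply: GB; apply: ih => //; rewrite ltn_subrL/= (leq_trans _ kj).
have : forall l, exists K : set M, 0 < l < l0 -> [/\ K `<=` B, f l @` K = K,
    attractor [set: M] (f l) K & same_shape R K (@sphere R n)].
  move=> l; have [l0l|nl] := boolP (0 < l < l0); last by exists set0.
  have /andP[lgt0 ll0] := l0l.
  have l_01 : 0 <= l <= 1 by rewrite (ltW lgt0) (ltW (lt_le_trans ll0 l01)).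
  have [|K KP] := sphere_attractor chart (fh l l_01) (fN l l_01) Np _ BV (VN l l_01)
    Bc Go GB GN rB r0 (trap l l0l); last by exists K.
  by apply: rep; rewrite lgt0; case/andP: l_01.
move=> /choice[K KP].
exists l0, K; split; first by rewrite l00.
  by move=> l /KP[].
move=> U /(_ p erefl) pU.
have [j _ /(_ j (leqnn j)) jU] := Eatt _ (nbhs_interior pU).
have jB x : B x -> U° (iter j (f 0) x) by move=> Bx; apply: jU => //; exact: BE.
have /nbhs_ballP[u /= u0 uP] :=
  iterate_persistence fc Bc (@open_interior _ U) jB.
exists (Num.min u l0); first by rewrite lt_min u0 l00 ge_min lexx orbT.
move=> l /andP[lgt0]; rewrite lt_min => /andP[lu ll0] x.
have [KB fK _ _] := KP l (introT andP (conj lgt0 ll0)).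
rewrite -{1}(image_iter j fK) => -[y /KB By <-]; apply: nbhs_singleton; apply: uP => //.
  by rewrite -ball_normE/= sub0r normrN gtr0_norm.
by rewrite /= in_itv/= (ltW lgt0) (ltW (lt_le_trans ll0 l01)).
Qed.
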